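(* Let $p \in (0,\infty)$, $p \neq 1$, put $p^* := p/(p-1)$, and let $x \in (0,1]$. Then $$\frac{1}{\mathrm{M}_p(1,x)} = \frac{2}{\pi_{p^*,p}}\,\mathcal{K}_{p^*,p}\big((1-x^p)^{\frac1p}\big) = F\left(\frac1p,\frac1p;\frac2p;1-x^p\right) = \left(\frac{1+x^p}{2}\right)^{-\frac1p} F\left(\frac{1}{2p},\frac{1}{2p}+\frac12;\frac1p+\frac12;\left(\frac{1-x^p}{1+x^p}\right)^2\right),$$ and $$\frac{1}{\mathrm{K}_p(1,x)} = F\left(1,\frac1p;2;1-x^p\right) = \left(\frac{1+x^p}{2}\right)^{-\frac1p} F\left(\frac{1}{2p},\frac{1}{2p}+\frac12;\frac32;\left(\frac{1-x^p}{1+x^p}\right)^2\right).$$ Consequently, for all $a,b>0$ with $a\neq b$: (i) $\mathrm{M}_p(a,b) > \mathrm{K}_p(a,b)$ if $0\le p<1$; (ii) $\mathrm{M}_1(a,b)=\mathrm{K}_1(a,b)$; (iii) $\mathrm{M}_p(a,b) < \mathrm{K}_p(a,b)$ if $p>1$.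
   Context: Means. For $p\in(0,\infty)$ and $a,b>0$, $\mathrm{M}_p(a,b)$ is defined by $$\frac{1}{\mathrm{M}_p(a,b)} := c_p\int_0^\infty \frac{dt}{((t^p+a^p)(t^p+b^p))^{\frac1p}},\qquad \frac{1}{c_p} := \int_0^\infty \frac{dt}{(1+t^p)^{\frac2p}},$$ so that $\mathrm{M}_p(a,a)=a$. Also $\mathrm{M}_0(a,b):=\lim_{p\to+0}\mathrm{M}_p(a,b)=\sqrt{ab}$. The power difference mean $\mathrm{K}_p(a,b)$ is defined for $p\in\mathbb{R}$ and $a,b>0$ by $$\mathrm{K}_p(a,b) := \frac{p-1}{p}\,\frac{a^p-b^p}{a^{p-1}-b^{p-1}}\ \ (a\neq b),\qquad \mathrm{K}_p(a,a):=a,$$ where for $p=0$ and $p=1$ the value is understood as the limit: $\mathrm{K}_0(a,b):=\lim_{p\to0}\mathrm{K}_p(a,b)=ab/\mathrm{L}(a,b)$ and $\mathrm{K}_1(a,b):=\lim_{p\to1}\mathrm{K}_p(a,b)=\mathrm{L}(a,b)$, with $\mathrm{L}(a,b):=\frac{a-b}{\log a-\log b}$ for $a\ne b$ and $\mathrm{L}(a,a):=a$. Complete $(r,q)$-elliptic integral of the first kind. For real numbers $r,q$ with $r^*:=r/(r-1)>0$ and $q>0$ ($r$ may be negative), let $$\pi_{r,q} := 2\int_0^1\frac{dt}{(1-t^q)^{\frac1r}},\qquad \mathcal{K}_{r,q}(k) := \int_0^1\frac{dt}{(1-t^q)^{\frac1r}(1-k^qt^q)^{1-\frac1r}}\quad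 (k\in[0,1)).$$ In the claim these are used with $r=p^*$ and $q=p$ (note $(p^* )^*=p>0$). Hypergeometric series. For $|z|<1$, $F(\alpha,\beta;\gamma;z):=\sum_{n=0}^\infty\frac{(\alpha)_n(\beta)_n}{(\gamma)_n}\frac{z^n}{n!}$, where $(\alpha)_0:=1$ and $(\alpha)_n:=\alpha(\alpha+1)\cdots(\alpha+n-1)$ for $n\ge1$. *)

(* Defs.v *)
From HB Require Import structures.
From mathcomp Require Import all_boot all_order all_algebra.
From mathcomp Require Import all_classical all_reals all_analysis.

Set Implicit Arguments.
Unset Strict Implicit.
Unset Printing Implicit Defensive.

Import Order.TTheory GRing.Theory Num.Theory.
Import numFieldNormedType.Exports.

Local Open Scope classical_set_scope.
Local Open Scope ring_scope.

Section Defs.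
Context {R : realType}.
Implicit Types (p q r a b t x z alpha beta gamma : R).

Local Notation mu := (@lebesgue_measure R).

(* Improper integrals of nonnegative functions are Lebesgue integrals. At an
   endpoint where such an integrand is singular it takes the junk value 0
   ([0^-1 = 0], and [0 `^ e = 0] for e != 0), which is irrelevant since a
   point is negligible. *)

Definition cM p : R :=
  (\int[mu]_(t in `[0, +oo[) ((1 + t `^ p) `^ (2 / p))^-1)^-1.

Definition Mpos p a b : R :=
  (cM p * \int[mu]_(t in `[0, +oo[)
            (((t `^ p + a `^ p) * (t `^ p + b `^ p)) `^ p^-1)^-1)^-1.

(* Only meaningful for p >= 0. *)
Definition M p a b : R :=
  if p == 0 then lim (Mpos q a b @[q --> 0^'+]) else Mpos p a b.

Definition Kgen p a b : R :=
  if a == b then a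
  else (p - 1) / p * ((a `^ p - b `^ p) / (a `^ (p - 1) - b `^ (p - 1))).

Definition K p a b : R :=
  if (p == 0) || (p == 1) then lim (Kgen q a b @[q --> p^'])
  else Kgen p a b.

Definition conjexp r : R := r / (r - 1).

Definition pi_rq r q : R :=
  2 * \int[mu]_(t in `[0, 1]) ((1 - t `^ q) `^ r^-1)^-1.

Definition ellK r q (k : R) : R :=
  \int[mu]_(t in `[0, 1])
    ((1 - t `^ q) `^ r^-1 * (1 - k `^ q * t `^ q) `^ (1 - r^-1))^-1.

Definition poch alpha (n : nat) : R := \prod_(i < n) (alpha + i%:R).

Definition hypF alpha beta gamma z : R :=
  limn (series (fun n : nat =>
    poch alpha n * poch beta n / poch gamma n * (z ^+ n / n`!%:R))).

End Defs.

(* Main.v *)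
Require Import Defs.
From HB Require Import structures.
From mathcomp Require Import all_boot all_order all_algebra.
From mathcomp Require Import all_classical all_reals all_analysis.
From mathcomp Require Import measurable_realfun ring lra.
Import Order.TTheory GRing.Theory Num.Theory.
Import numFieldNormedType.Exports.
Local Open Scope classical_set_scope.
Local Open Scope ring_scope.
Set Implicit Arguments.
Unset Strict Implicit.

(** Put z = 1 - x^p and zeta = z / (2 - z) = (1 - x^p) / (1 + x^p).

    Series form of M.  On the half line take the weight f(t) = (1 + t^p)^(-2/p)
    and the function h(t) = 1 / (1 + t^p), with values in [0, 1).  The integrand
    of 1 / (c_p M_p(1, x)) is f (1 - z h)^(-1/p), so the binomial series and monotone
    convergence express the integral through the moments of h against f.
    Integrating the derivative of t (1 + t^p)^(-2/p - n) shows that consecutive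
    moments have ratio (1/p + n) / (2/p + n); normalised by c_p they are
    (1/p)_n / (2/p)_n, and the sum is F(1/p, 1/p; 2/p; z).  On ]0, 1[ the weight
    (1 - u^p)^(1/p - 1) and the function u^p satisfy the same recurrence, which
    is natural since u^p = 1 / (1 + t^p) maps one situation to the other.  As
    both integrals are normalised by their own total mass, the recurrence alone
    identifies them, and no change of variables is carried out: [integral_hyp]
    is applied once in [halfline_hypF] and once in [unit_interval_hypF].

    Series form of K.  The function s F(1, b; 2; s) is the primitive of
    (1 - s)^(-b) that vanishes at 0 ([hypF12_primitive]), hence an elementary
    function: a power for b <> 1 and a logarithm for b = 1.  With b = 1/p and
    s = z its value is z / K_p(1, x), including p = 1.

    Quadratic transformation.  Both series have the shape F(a, b; 2b; z), with
    (a, b) = (1/p, 1/p) for M and (1/p, 1) for K.  The numbers (b)_n / (2b)_n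
    are the moments of a distribution on [0, 1] that is symmetric about 1/2.
    Writing v = (1 + w) / 2 gives
    1 - z v = (1 - z/2) (1 - zeta w), and only even powers of w survive:
    F(a, b; 2b; z) =
    (1 - z/2)^(-a) F(a/2, a/2 + 1/2; b + 1/2; zeta^2).
    [symmoment_binomial] is the algebraic form of the symmetry, and
    [quadratic_transformation] sums it up by exchanging series of nonnegative
    terms.

    Comparison.  After the transformation, 1 / M_p and 1 / K_p have the same
    prefactor and differ only in the third parameter, 1/p + 1/2 against 3/2.
    The series is strictly decreasing in that parameter ([hypF_lt]), so the
    order of the means is decided by the sign of p - 1.  Replacing the third
    parameter by 1/(2p) + 1/2, which turns the series into a power, yields
    sqrt x < M_p(1, x).  Together with the upper bound by the power mean
    ((1 + x^p) / 2)^(1/p) this gives the limit M_0 = sqrt (a b), and for p = 1,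
    where M_1 = K_1 = L, it gives K_0 = a b / L < sqrt (a b).  General arguments a, b
    reduce to (1, b / a) by homogeneity and symmetry. *)

(** * Rising factorials *)

Section Poch.
Context {R : realType}.
Implicit Types a b : R.

Lemma poch0 a : poch a 0 = 1.
Proof. by rewrite /poch big_ord0. Qed.

Lemma pochS a n : poch a n.+1 = poch a n * (a + n%:R).
Proof. by rewrite /poch big_ord_recr. Qed.

Lemma poch_gt0 a n : 0 < a -> 0 < poch a n.
Proof. by move=> a0; apply: prodr_gt0 => i _; rewrite ltr_wpDr. Qed.

Lemma poch1 n : poch (1 : R) n = n`!%:R.
Proof.
elim: n => [|n IH]; first by rewrite poch0.
by rewrite pochS IH factS natrM mulrC -natr1 addrC.
Qed.

Lemma pochD a m n : poch a (m + n) = poch a m * poch (a + m%:R) n.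
Proof.
elim: n => [|n IH]; first by rewrite addn0 poch0 mulr1.
by rewrite addnS !pochS IH natrD addrA mulrA.
Qed.

Lemma poch_recl a n : poch a n.+1 = a * poch (a + 1) n.
Proof. by rewrite -add1n pochD pochS poch0 mul1r addr0. Qed.

Lemma poch_double a k :
  poch a k.*2 = 4 ^+ k * poch (a / 2) k * poch (a / 2 + 2^-1) k.
Proof.
elim: k => [|k IH]; first by rewrite !poch0 !mulr1.
rewrite doubleS !pochS IH exprS -!natr1 -!mul2n !natrM.
by field.
Qed.

Lemma fact_double k : (k.*2)`!%:R = 4 ^+ k * k`!%:R * poch (2^-1 : R) k.
Proof.
rewrite -poch1 poch_double mul1r -mulrA [_ * poch (_ + _) _]mulrC.
rewrite (_ : 2^-1 + 2^-1 = 1 :> R); last by field.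
by rewrite poch1 mulrA.
Qed.

Lemma poch_le a b n : 0 < a -> a <= b -> poch a n <= poch b n.
Proof.
move=> a0 ab; apply: ler_prod => i _.
by rewrite addr_ge0 ?(ltW a0)//= lerD2r.
Qed.

End Poch.

(** * Power series on the unit interval *)

Section RatioTest.
Context {R : realType}.

Lemma cvg_series_ratio (u : R^nat) (N : nat) (r : R) :
  (forall n, 0 <= u n) -> 0 <= r < 1 ->
  (forall n, (N <= n)%N -> u n.+1 <= r * u n) -> cvgn (series u).
Proof.
move=> u0 /andP[r0 r1] ur.
have bnd n : u (n + N)%N <= geometric (u N) r n.
  elim: n => [|n IH]; first by rewrite /= expr0 mulr1.
  rewrite addSn (le_trans (ur _ (leq_addl _ _)))//=.
  by rewrite exprS mulrCA ler_wpM2l.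
have cv : cvgn (series (fun n => u (n + N)%N)).
  apply: (series_le_cvg _ _ bnd) => [n|n|]; first exact: u0.
    exact: geometric_ge0.
  by apply: is_cvg_geometric_series; rewrite ger0_norm.
rewrite -(is_cvg_series_restrict N).
have /cvg_ex[l cl] := cv; apply/cvg_ex; exists l; rewrite -(cvg_shiftn N).
rewrite (_ : [sequence _]_n = series (fun n => u (n + N)%N))//.
by apply/funext => n /=; rewrite seriesEnat /= -{1}(add0n N) big_addn addnK.
Qed.

(** For 0 <= z < r < 1 one has (A + n) z <= r (n + 1) for all large n, so the
    plain ratio test applies. *)
Lemma cvg_series_linear_ratio (u : R^nat) (A z : R) :
  (forall n, 0 <= u n) -> 0 <= A -> 0 <= z < 1 ->
  (forall n, (0 < n)%N -> n.+1%:R * u n.+1 <= (A + n%:R) * z * u n) ->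
  cvgn (series u).
Proof.
move=> u0 A0 /andP[z0 z1] ur.
pose r := (1 + z) / 2.
have rz : 0 < r - z by rewrite /r; lra.
have [N NP] : exists N : nat, A * z <= N%:R * (r - z).
  exists (Num.bound (A * z / (r - z))).
  rewrite -ler_pdivrMr// ltW// archi_boundP// divr_ge0 ?mulr_ge0//.
  exact: ltW.
apply: (@cvg_series_ratio _ N.+1 r) => // [|n Nn]; first by rewrite /r; lra.
have n0 : (0 : R) < n.+1%:R by [].
rewrite -(ler_pM2l n0) (le_trans (ur _ _))//; first exact: leq_ltn_trans Nn.
rewrite mulrA ler_wpM2r//.
have : (N%:R : R) <= n%:R by rewrite ler_nat ltnW.
move=> /(ler_wpM2r (ltW rz)) h.
have := le_trans NP h; rewrite -natr1 /r; lra.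
Qed.

End RatioTest.

Section PowerSeries.
Context {R : realType}.
Implicit Types (a b s z x : R) (c : R^nat).

Lemma derive0_constant (D : R -> R) z : 0 <= z ->
  (forall x, 0 <= x <= z -> is_derive x (1 : R) D 0) -> D z = D 0.
Proof.
move=> z0 dD.
have [c _ E] : exists2 c, c \in `[0, z]%R & D z - D 0 = 0 * (z - 0).
  apply: (@MVT_segment _ _ (fun=> 0)) => // [x|].
    by rewrite in_itv => /andP[? ?]; apply: dD; rewrite !ltW.
  apply: derivable_within_continuous => x; rewrite in_itv => /dD h.
  exact: ex_derive.
by move: E; rewrite mul0r => /eqP; rewrite subr_eq0 => /eqP.
Qed.

Lemma limn_pseries0 c : limn (pseries c 0) = c 0%N.
Proof.
rewrite (_ : pseries c 0 = fun n => (0 < n)%N%:R * c 0%N).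
  apply/cvg_lim => //.
  rewrite -(cvg_shiftS (fun n => (0 < n)%N%:R * c 0%N)) /=.
  rewrite (_ : (fun n => _) = fun=> c 0%N); first exact: cvg_cst.
  by apply/funext => n; rewrite mul1r.
apply/funext => -[|n]; rewrite /pseries seriesEnat /= ?big_nil ?mul0r//.
rewrite big_nat_recl//= expr0 mulr1 mul1r big1 ?addr0// => i _.
by rewrite expr0n mulr0.
Qed.

(** All series below have nonnegative coefficients and are evaluated on [0, 1[
    only, which is also where the ratio test is stated. *)
Definition cvg01 c := forall x, 0 <= x < 1 -> cvgn (pseries c x).

Lemma is_derive_pseries01 c z :
  cvg01 c -> cvg01 (pseries_diffs c) -> cvg01 (pseries_diffs (pseries_diffs c)) ->
  0 <= z < 1 ->
  is_derive z (1 : R) (fun x => limn (pseries c x))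
    (limn (pseries (pseries_diffs c) z)).
Proof.
move=> c0 c1 c2 /andP[z0 z1].
pose K := (1 + z) / 2.
have K01 : 0 <= K < 1 by rewrite /K; lra.
apply: (@pseries_snd_diffs _ c K) => //; [exact: c0|exact: c1|exact: c2|].
by rewrite !ger0_norm// /K; lra.
Qed.

Lemma cvg01_ratio c A : (forall n, 0 <= c n) -> 0 <= A ->
  (forall n, (0 < n)%N -> n.+1%:R * c n.+1 <= (A + n%:R) * c n) -> cvg01 c.
Proof.
move=> c0 A0 cr x x01; have /andP[x0 _] := x01.
apply: (@cvg_series_linear_ratio _ _ A x) => // n.
  by rewrite mulr_ge0// exprn_ge0.
move=> n0 /=; rewrite exprS.
have := ler_wpM2r (mulr_ge0 (exprn_ge0 n x0) x0) (cr n n0).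
lra.
Qed.

(** The Taylor coefficients of [(1 - x) `^ (- a)]. *)
Definition bincoef a n : R := poch a n / n`!%:R.

Lemma bincoef_gt0 a n : 0 < a -> 0 < bincoef a n.
Proof. by move=> a0; rewrite divr_gt0 ?poch_gt0// ltr0n fact_gt0. Qed.

Lemma natr_fact_neq0 n : n`!%:R != 0 :> R.
Proof. by rewrite pnatr_eq0 -lt0n fact_gt0. Qed.

Lemma bincoefS a n : n.+1%:R * bincoef a n.+1 = (a + n%:R) * bincoef a n.
Proof.
rewrite /bincoef pochS factS natrM; have := natr_fact_neq0 n => f0.
by field; rewrite f0 nat1r pnatr_eq0.
Qed.

Lemma cvg01_bincoef a : 0 < a -> cvg01 (bincoef a).
Proof.
move=> a0; apply: (@cvg01_ratio _ a) => [n||n _]; [|exact: ltW|].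
  by rewrite ltW// bincoef_gt0.
by rewrite bincoefS.
Qed.

Lemma pseries_diffs_bincoef a :
  pseries_diffs (bincoef a) = a \o* bincoef (a + 1).
Proof.
apply/funext => n; rewrite /pseries_diffs /bincoef poch_recl factS natrM /=.
by have f0 := natr_fact_neq0 n; field; rewrite f0 nat1r pnatr_eq0.
Qed.

Lemma pseriesZ c k x : pseries (k \o* c) x = k \o* pseries c x.
Proof.
apply/funext => n; rewrite /pseries !seriesEnat /= mulr_suml.
by apply: eq_bigr => i _; rewrite mulrAC.
Qed.

Lemma cvg01Z c k : cvg01 c -> cvg01 (k \o* c).
Proof. by move=> cc x /cc; rewrite pseriesZ; exact: is_cvgMl. Qed.

Lemma pseries_diffsZ c k : pseries_diffs (k \o* c) = k \o* pseries_diffs c.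
Proof. by apply/funext => n; rewrite /pseries_diffs /= mulrA. Qed.

Lemma is_derive_binseries a z : 0 < a -> 0 <= z < 1 ->
  is_derive z (1 : R) (fun x => limn (pseries (bincoef a) x))
    (a * limn (pseries (bincoef (a + 1)) z)).
Proof.
move=> a0 z01.
have a1 : 0 < a + 1 by lra.
have a2 : 0 < a + 1 + 1 by lra.
have -> : a * limn (pseries (bincoef (a + 1)) z) =
    limn (pseries (pseries_diffs (bincoef a)) z).
  rewrite pseries_diffs_bincoef pseriesZ mulrC; apply/esym/cvg_lim => //.
  by apply: cvgMl; exact: cvg01_bincoef.
apply: is_derive_pseries01 => //; first exact: cvg01_bincoef.
  by rewrite pseries_diffs_bincoef; apply/cvg01Z/cvg01_bincoef.
rewrite pseries_diffs_bincoef pseries_diffsZ pseries_diffs_bincoef.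
by do 2 apply: cvg01Z; exact: cvg01_bincoef.
Qed.

(** Multiplying by 1 - z telescopes the coefficients: the difference of
    consecutive coefficients for a + 1 is the coefficient for a. *)
Lemma binseries_contiguous a z : 0 < a -> 0 <= z < 1 ->
  (1 - z) * limn (pseries (bincoef (a + 1)) z) = limn (pseries (bincoef a) z).
Proof.
move=> a0 z01; have a1 : 0 < a + 1 by lra.
have cv := cvg01_bincoef a1 z01.
apply/esym/cvg_lim => //; rewrite -cvg_shiftS.
have E n : pseries (bincoef a) z n.+1 =
    (1 - z) * pseries (bincoef (a + 1)) z n.+1 + z * (bincoef (a + 1) n * z ^+ n).
  elim: n => [|n IH].
    rewrite /pseries !seriesEnat /= !big_nat1 /bincoef !poch0 !expr0; ring.
  move: IH; rewrite /pseries !seriesEnat /= => IH.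
  rewrite big_nat_recr//= IH [in RHS]big_nat_recr//=.
  rewrite /bincoef poch_recl !pochS factS natrM exprS -natr1.
  have f0 := natr_fact_neq0 n.
  have n0 : (n%:R + 1 : R) != 0 by rewrite natr1 pnatr_eq0.
  by field; rewrite f0.
under eq_fun do rewrite E.
rewrite -(addr0 ((1 - z) * _)); apply: cvgD.
  apply: cvgMr; rewrite (cvg_shiftS (pseries (bincoef (a + 1)) z)).
  exact: cv.
rewrite -(mulr0 z); apply: cvgMr.
exact: cvg_series_cvg_0 cv.
Qed.

Lemma is_derive_onem x : is_derive x (1 : R) (fun s : R => 1 - s) (- 1).
Proof. by rewrite -[X in is_derive _ _ _ X]add0r; apply: is_deriveB. Qed.

Lemma is_derive_powR_onem e x : x < 1 ->
  is_derive x (1 : R) (fun s => (1 - s) `^ e) (- (e * (1 - x) `^ (e - 1))).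
Proof.
move=> x1.
have h := is_derive_onem x.
have g : is_derive (1 - x) (1 : R) (@powR R ^~ e) (e * (1 - x) `^ (e - 1)).
  by apply: is_derive1_powR; lra.
have := @is_derive1_comp R (@powR R ^~ e) (fun s : R => 1 - s) x _ _ g h.
by rewrite mulrN1.
Qed.

(** The quotient of the two sides has derivative 0: the series has derivative
    a times the series for a + 1, which is the series itself over 1 - x. *)
Lemma binomial_series a z : 0 < a -> 0 <= z < 1 ->
  limn (pseries (bincoef a) z) = (1 - z) `^ (- a).
Proof.
move=> a0 z01; have /andP[z0 z1] := z01.
pose D s : R := (1 - s) `^ a * limn (pseries (bincoef a) s).
have E : D z = D 0.
  apply: derive0_constant => // x /andP[x0 xz].
  have x1 : x < 1 by exact: le_lt_trans z1.
  have x01 : 0 <= x < 1 by rewrite x0.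
  have := is_deriveM (is_derive_powR_onem a x1) (is_derive_binseries a0 x01).
  move=> h; apply: is_derive_eq h _.
  rewrite /GRing.scale /= -(binseries_contiguous a0 x01).
  rewrite -(@mulr_powRB1 _ (1 - x) a) ?subr_ge0 ?ltW//.
  ring.
move: E; rewrite /D limn_pseries0 subr0 powR1 mul1r /bincoef poch0 fact0 divr1.
rewrite powRN => /(canRL (mulKf _)) ->; first by rewrite mulr1.
by rewrite gt_eqF// powR_gt0// subr_gt0.
Qed.

End PowerSeries.

(** * The quadratic transformation *)

Section SymmetricMoments.
Context {R : realType}.
Variable b : R.
Hypothesis b0 : 0 < b.

(** The moment of order 2k of the probability law on [-1, 1] with density
    proportional to (1 - w^2)^(b - 1). *)
Definition symmoment k : R := poch 2^-1 k / poch (b + 2^-1) k.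

Let bh_gt0 : 0 < b + 2^-1. Proof. by have := b0; lra. Qed.

Lemma symmoment_ge0 k : 0 <= symmoment k.
Proof. by rewrite divr_ge0// ltW// poch_gt0// invr_gt0. Qed.

Lemma symmomentS k :
  (2 * b + k.*2.+1%:R) * symmoment k.+1 = k.*2.+1%:R * symmoment k.
Proof.
rewrite /symmoment !pochS -(natr1 k.*2) -(mul2n k) natrM.
have h : poch (b + 2^-1) k != 0 by rewrite gt_eqF// poch_gt0.
have h' : b + 2^-1 + k%:R != 0 by rewrite gt_eqF// ltr_wpDr.
field; rewrite h /=.
by move: h'; apply: contra => /eqP e; apply/eqP; lra.
Qed.

(** With w distributed by that law, [evenpart N n] is the mean of (1 + w)^n and
   [oddpart N n] the mean of w (1 + w)^n, as soon as N is large enough. *)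
Let evenpart N n : R := \sum_(k < N) 'C(n, k.*2)%:R * symmoment k.
Let oddpart N n : R := \sum_(k < N) 'C(n, k.*2.+1)%:R * symmoment k.+1.

Let evenpartS N n : (n.+1 < N)%N -> evenpart N n.+1 = evenpart N n + oddpart N n.
Proof.
case: N => // N; rewrite ltnS => nN; rewrite /evenpart /oddpart.
rewrite big_ord_recl [X in _ = X + _]big_ord_recl [X in _ = _ + X]big_ord_recr /=.
rewrite (@bin_small n N.*2.+1) ?mul0r ?addr0; last first.
  by rewrite ltnS (leq_trans (ltnW nN))// -addnn leq_addr.
rewrite !bin0 -addrA; congr (_ + _); rewrite -big_split /=.
apply: eq_bigr => i _; rewrite /bump /= add1n doubleS binS natrD mulrDl.
by [].
Qed.

(** This is the identity E[n (1 - w^2) (1 + w)^(n-1)] = 2 b E[w (1 + w)^n]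
   (integration by parts) read on coefficients. *)
Let oddpartE N n : (n < N)%N -> (2 * b + n%:R) * oddpart N n = n%:R * evenpart N n.
Proof.
case: N => // N nN; rewrite /evenpart /oddpart.
have -> : (2 * b + n%:R) * (\sum_(k < N.+1) 'C(n, k.*2.+1)%:R * symmoment k.+1) =
    \sum_(k < N.+1) (n - k.*2)%N%:R * 'C(n, k.*2)%:R * symmoment k +
    \sum_(k < N.+1) (k.+1).*2%:R * 'C(n, (k.+1).*2)%:R * symmoment k.+1.
  rewrite mulr_sumr -big_split /=; apply: eq_bigr => k _.
  have [nk|kn] := leqP n k.*2.
    rewrite (@bin_small n k.*2.+1) ?ltnS// mul0r mulr0.
    move: (nk); rewrite -subn_eq0 => /eqP ->; rewrite !mul0r add0r.
    by rewrite bin_small ?mulr0 ?mul0r// doubleS ltnS (leq_trans nk).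
  have e1 : (n - k.*2)%N%:R * 'C(n, k.*2)%:R = k.*2.+1%:R * 'C(n, k.*2.+1)%:R :> R.
    by rewrite -!natrM mul_bin_left.
  have e2 : (k.+1).*2%:R * 'C(n, (k.+1).*2)%:R = (n%:R - k.*2.+1%:R) * 'C(n, k.*2.+1)%:R :> R.
    by rewrite -natrB// -!natrM doubleS mul_bin_left.
  rewrite e1 e2.
  rewrite (mulrAC _ _ (symmoment k)) -symmomentS; ring.
rewrite [X in _ + X]big_ord_recr /= (@bin_small n) ?mulr0 ?mul0r ?addr0; last first.
  by rewrite (leq_trans nN)// -addnn leq_addl.
rewrite mulr_sumr [in RHS]big_ord_recl [X in X + _]big_ord_recl /= subn0 -addrA.
rewrite mulrA; congr (_ + _); rewrite -big_split /=; apply: eq_bigr => i _.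
rewrite /bump /= add1n [in RHS]mulrA -mulrDl -mulrDl.
have [h|h] := leqP (i.+1).*2 n; first by rewrite -natrD subnK.
by rewrite bin_small// !mulr0 !mul0r.
Qed.

(** If v has moments (b)_n / (2b)_n, then w = 2 v - 1 is symmetric with even
    moments [symmoment]; here the moments of v are recovered by expanding
    v^n = ((1 + w) / 2)^n. *)
Lemma symmoment_binomial N n : (n < N)%N ->
  2 ^+ n * poch b n =
  poch (2 * b) n * \sum_(k < N) 'C(n, k.*2)%:R * symmoment k.
Proof.
rewrite -/(evenpart N n); elim: n => [|n IH] nN.
  rewrite /evenpart expr0 !poch0; case: N nN => // N _.
  rewrite big_ord_recl /= bin0 big1 ?addr0; last first.
    by move=> i _; rewrite bin_small ?mul0r.
  by rewrite /symmoment !poch0; field.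
have nN' := ltnW nN.
rewrite exprS !pochS evenpartS//.
transitivity (2 * (b + n%:R) * (2 ^+ n * poch b n)); first by ring.
rewrite IH// -[RHS]mulrA [in RHS]mulrDr oddpartE//; ring.
Qed.

End SymmetricMoments.

Section Hyp.
Context {R : realType}.
Implicit Types (a b g x z : R).

Definition hypcoef a b g n : R := poch a n * poch b n / poch g n / n`!%:R.

Lemma hypFE a b g z : hypF a b g z = limn (pseries (hypcoef a b g) z).
Proof.
rewrite /hypF /pseries; congr (limn (series _)); apply/funext => n.
by rewrite /hypcoef mulrA mulrAC.
Qed.

Lemma hypFC a b g z : hypF a b g z = hypF b a g z.
Proof.
by rewrite /hypF; congr (limn (series _)); apply/funext => n; rewrite (mulrC (poch a n)).
Qed.

Lemma hypcoef_gt0 a b g n : 0 < a -> 0 < b -> 0 < g -> 0 < hypcoef a b g n.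
Proof.
by move=> *; rewrite divr_gt0 ?divr_gt0 ?mulr_gt0 ?poch_gt0// ltr0n fact_gt0.
Qed.

Lemma cvg01_hypcoef a b g : 0 < a -> 0 < b -> 0 < g -> cvg01 (hypcoef a b g).
Proof.
move=> a0 b0 g0; apply: (@cvg01_ratio _ _ (a + b + a * b / g)).
- by move=> n; rewrite ltW// hypcoef_gt0.
- by rewrite !addr_ge0 ?ltW// divr_gt0// mulr_gt0.
move=> n _.
have gn : 0 < g + n%:R by rewrite ltr_wpDr.
have -> : n.+1%:R * hypcoef a b g n.+1 =
    (a + n%:R) * (b + n%:R) / (g + n%:R) * hypcoef a b g n.
  rewrite /hypcoef !pochS factS natrM.
  have f0 := @natr_fact_neq0 R n.
  have h : poch g n != 0 by rewrite gt_eqF// poch_gt0.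
  by field; rewrite f0 h nat1r pnatr_eq0 /= gt_eqF.
rewrite ler_wpM2r//; first by rewrite ltW// hypcoef_gt0.
rewrite ler_pdivrMr//.
have -> : (a + b + a * b / g + n%:R) * (g + n%:R) =
  (a + n%:R) * (b + n%:R) + (a * g + b * g + (a * b / g + g) * n%:R).
  by field; rewrite gt_eqF.
rewrite lerDl !addr_ge0 ?mulr_ge0 ?addr_ge0 ?(ltW g0) ?(ltW a0) ?(ltW b0)//.
by rewrite divr_ge0 ?mulr_ge0 ?ltW.
Qed.

(** Sums of nonnegative terms are exchanged in the extended reals, where no
    convergence has to be carried along. *)
Lemma pseries_ereal c x : cvg01 c -> 0 <= x < 1 ->
  (\sum_(n <oo) (c n * x ^+ n)%:E)%E = (limn (pseries c x))%:E.
Proof.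
move=> cc x01; rewrite -(EFin_lim (cc _ x01)).
by apply: congr_lim; apply/funext => n /=; rewrite /pseries seriesEnat /= sumEFin.
Qed.

(** Expanding (b)_n / (2b)_n by [symmoment_binomial] gives a double series; for
    fixed k the sum over n >= 2k is the binomial series of exponent a + 2k at
    z / 2, which leaves the powers of z / (2 - z). *)
Lemma quadratic_transformation a b z : 0 < a -> 0 < b -> 0 <= z < 1 ->
  hypF a b (2 * b) z =
  (1 - z / 2) `^ (- a) *
  hypF (a / 2) (a / 2 + 2^-1) (b + 2^-1) ((z / (2 - z)) ^+ 2).
Proof.
move=> a0 b0 z01; have /andP[z0 z1] := z01.
have b20 : 0 < 2 * b by lra.
have a20 : 0 < a / 2 by lra.
have a21 : 0 < a / 2 + 2^-1 by lra.
have bh0 : 0 < b + 2^-1 by lra.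
have z2 : 0 <= z / 2 < 1 by lra.
pose s := z / 2.
have s0 : 0 <= s by rewrite /s; lra.
have s1 : 0 < 1 - s by rewrite /s; lra.
pose zeta := (z / (2 - z)).
have zetaE : zeta = s / (1 - s) by rewrite /zeta /s; field; rewrite gt_eqF//; lra.
have zeta01 : 0 <= zeta ^+ 2 < 1.
  rewrite exprn_ge0 ?expr_lt1 ?zetaE ?divr_ge0 ?(ltW s1)//=.
  by rewrite ltr_pdivrMr// /s; lra.
apply: EFin_inj; rewrite EFinM !hypFE -!pseries_ereal//; [|exact: cvg01_hypcoef..].
pose t n k : R := bincoef a n * s ^+ n * ('C(n, k.*2)%:R * symmoment b k).
have t0 n k : (0 <= (t n k)%:E)%E.
  rewrite lee_fin; apply: mulr_ge0; apply: mulr_ge0 => //.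
  - by rewrite ltW// bincoef_gt0.
  - exact: exprn_ge0.
  - exact: symmoment_ge0.
transitivity (\sum_(n <oo) \sum_(k <oo) (t n k)%:E)%E.
  apply: eq_eseriesr => n _.
  rewrite (@nneseries_split _ _ 0 n.+1); last by move=> *; exact: t0.
  rewrite add0n eseries0 ?adde0; last first.
    move=> k nk _; rewrite /t bin_small ?mul0r ?mulr0//.
    by rewrite (leq_trans nk)// -addnn leq_addr.
  rewrite sumEFin big_mkord; congr EFin.
  rewrite -mulr_sumr.
  have h : poch (2 * b) n != 0 by rewrite gt_eqF// poch_gt0.
  rewrite /hypcoef /bincoef /s expr_div_n.
  have := symmoment_binomial b0 (ltnSn n); set S := \sum_(_ < _) _ => e.
  have e' : poch b n = poch (2 * b) n * S / 2 ^+ n.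
    by rewrite -e mulrC mulKf// expf_neq0.
  have f0 := @natr_fact_neq0 R n.
  have p0 : (2 ^+ n : R) != 0 by rewrite expf_neq0.
  by rewrite e'; field; rewrite h f0 p0.
rewrite nneseries_interchange//.
rewrite -nneseriesZl; last first.
  move=> k _; rewrite lee_fin; apply: mulr_ge0.
    by rewrite ltW// hypcoef_gt0.
  by apply: exprn_ge0; have /andP[] := zeta01.
apply: eq_eseriesr => k _.
rewrite (@nneseries_split _ _ 0 k.*2); last by move=> *; exact: t0.
rewrite big1_seq ?add0e ?add0n; last first.
  move=> n; rewrite mem_index_iota => /andP[_ /andP[_ nk]].
  by rewrite /t bin_small ?mul0r ?mulr0.
rewrite -nneseries_addn//.
have ak : 0 < a + k.*2%:R by rewrite ltr_wpDr.
(* (a)_(2k+j) = (a)_(2k) (a+2k)_j and C(2k+j, 2k) / (2k+j)! = 1 / ((2k)! j!) *)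
transitivity (\sum_(j <oo)
    ((bincoef a k.*2 * s ^+ k.*2 * symmoment b k)%:E *
     (bincoef (a + k.*2%:R) j * s ^+ j)%:E))%E.
  apply: eq_eseriesr => j _; rewrite -EFinM; congr EFin.
  rewrite /t /bincoef addnC pochD exprD.
  have := bin_fact (leq_addr j k.*2); rewrite addKn => /(congr1 (fun n => n%:R : R)).
  rewrite !natrM => <-.
  have C0 : 'C(k.*2 + j, k.*2)%:R != 0 :> R.
    by rewrite pnatr_eq0 -lt0n bin_gt0 leq_addr.
  by field; rewrite !natr_fact_neq0 C0.
rewrite nneseriesZl; last first.
  move=> j _; rewrite lee_fin; apply: mulr_ge0; last exact: exprn_ge0.
  by rewrite ltW// bincoef_gt0.
rewrite pseries_ereal//; last exact: cvg01_bincoef.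
rewrite binomial_series// -!EFinM; congr EFin.
rewrite opprD powRD; last by rewrite (gt_eqF s1) implybT.
rewrite powR_invn ?(ltW s1)//.
rewrite -/zeta zetaE /symmoment /hypcoef /bincoef poch_double fact_double.
rewrite -!exprM mul2n [in RHS]expr_div_n -/s.
have p0 : (4 ^+ k : R) != 0 by rewrite expf_neq0.
have h1 : poch (b + 2^-1) k != 0 by rewrite gt_eqF// poch_gt0.
have h2 : poch (2^-1 : R) k != 0 by rewrite gt_eqF// poch_gt0 ?invr_gt0.
have h3 : (1 - s) ^+ k.*2 != 0 by rewrite expf_neq0// gt_eqF.
by field; rewrite h1 h2 h3 p0 natr_fact_neq0.
Qed.

End Hyp.

(** * Special values and monotonicity of hypergeometric series *)

Section HypergeometricValues.
Context {R : realType}.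
Implicit Types (a b g x z : R).

Lemma hypF_same a b z : 0 < a -> 0 < b -> 0 <= z < 1 ->
  hypF a b b z = (1 - z) `^ (- a).
Proof.
move=> a0 b0 z01; rewrite hypFE -binomial_series//.
congr (limn (pseries _ _)); apply/funext => n.
by rewrite /hypcoef mulfK// gt_eqF// poch_gt0.
Qed.

Lemma limn_pseries_ge_partial c z m : (forall n, 0 <= c n) -> cvg01 c ->
  0 <= z < 1 -> pseries c z m <= limn (pseries c z).
Proof.
move=> c0 cc z01; apply: nondecreasing_cvgn_le; last exact: cc.
apply/nondecreasing_seqP => n; rewrite /pseries !seriesEnat /= big_nat_recr//=.
by rewrite lerDl mulr_ge0// exprn_ge0//; have /andP[] := z01.
Qed.

Lemma hypF_ge1 a b g z : 0 < a -> 0 < b -> 0 < g -> 0 <= z < 1 ->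
  1 <= hypF a b g z.
Proof.
move=> a0 b0 g0 z01; rewrite hypFE.
have := @limn_pseries_ge_partial (hypcoef a b g) z 1 _ _ z01.
rewrite /pseries seriesEnat /= big_nat1 /hypcoef !poch0 fact0 expr0 !(mulr1, divr1).
apply; last exact: cvg01_hypcoef.
by move=> n; rewrite ltW// hypcoef_gt0.
Qed.

Lemma poch_lt a b n : 0 < a -> a < b -> poch a n.+1 < poch b n.+1.
Proof.
move=> a0 ab; rewrite !poch_recl.
have a1 : 0 < a + 1 by lra.
apply: (@lt_le_trans _ _ (b * poch (a + 1) n)).
  by rewrite ltr_pM2r// poch_gt0.
by rewrite ler_wpM2l ?poch_le// ?lerD2r; lra.
Qed.

(** Termwise comparison; the terms of index 1 already differ. *)
Lemma hypF_lt a b g g' z : 0 < a -> 0 < b -> 0 < g -> g < g' -> 0 < z < 1 ->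
  hypF a b g' z < hypF a b g z.
Proof.
move=> a0 b0 g0 gg' /andP[z0 z1]; have g'0 := lt_trans g0 gg'.
have z01 : 0 <= z < 1 by rewrite z1 ltW.
pose d := hypcoef a b g - hypcoef a b g'.
have dE n x : d n * x ^+ n = (hypcoef a b g n * x ^+ n) - (hypcoef a b g' n * x ^+ n).
  by rewrite mulrBl.
have cg := cvg01_hypcoef a0 b0 g0; have cg' := cvg01_hypcoef a0 b0 g'0.
have pd x : pseries d x = pseries (hypcoef a b g) x - pseries (hypcoef a b g') x.
  apply/funext => n; rewrite !fctE /pseries !seriesEnat /= -sumrB.
  by apply: eq_bigr => i _; exact: dE.
have d0 n : 0 <= d n.
  rewrite subr_ge0 ler_pM2r ?invr_gt0 ?ltr0n ?fact_gt0//.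
  rewrite ler_pM2l ?mulr_gt0 ?poch_gt0// lef_pV2 ?posrE ?poch_gt0//.
  by rewrite poch_le ?ltW.
have cd : cvg01 d by move=> x x01; rewrite pd; apply: is_cvgB; [exact: cg|exact: cg'].
rewrite -subr_gt0 !hypFE.
have <- : limn (pseries d z) = limn (pseries (hypcoef a b g) z) - limn (pseries (hypcoef a b g') z).
  by rewrite pd limB//; [exact: cg|exact: cg'].
apply: lt_le_trans (@limn_pseries_ge_partial d z 2 d0 cd z01).
rewrite /pseries seriesEnat /= big_nat_recr//= big_nat1 ltr_wpDl//.
  by rewrite mulr_ge0.
rewrite mulr_gt0// subr_gt0 ltr_pM2r ?invr_gt0 ?ltr0n//.
by rewrite ltr_pM2l ?mulr_gt0 ?poch_gt0// ltf_pV2 ?posrE ?poch_gt0// poch_lt.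
Qed.

(** The coefficients of s F(1, b; 2; s), that is (b)_(n-1) / n!. *)
Let primcoef b n : R := if n is m.+1 then poch b m / n`!%:R else 0.

(** Differentiating s F(1, b; 2; s) termwise gives the binomial series of
    (1 - s)^(-b). *)
Lemma hypF12_primitive b (Phi : R -> R) z : 0 < b -> 0 <= z < 1 ->
  (forall x, 0 <= x < 1 -> is_derive x (1 : R) Phi ((1 - x) `^ (- b))) ->
  Phi 0 = 0 -> z * hypF 1 b 2 z = Phi z.
Proof.
move=> b0 z01 dPhi Phi0.
have dw : pseries_diffs (primcoef b) = bincoef b.
  apply/funext => n; rewrite /pseries_diffs /primcoef /bincoef factS natrM.
  by have f0 := @natr_fact_neq0 R n; field; rewrite f0 nat1r pnatr_eq0.
have cw : cvg01 (primcoef b).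
  apply: (@cvg01_ratio _ _ b) => [[|n]||[|n] _] //=.
  - by rewrite ltW// divr_gt0 ?poch_gt0// ltr0n fact_gt0.
  - exact: ltW.
  have p0 : 0 < poch b n / (n.+1)`!%:R by rewrite divr_gt0 ?poch_gt0// ltr0n fact_gt0.
  have -> : n.+2%:R * (poch b n.+1 / (n.+2)`!%:R) =
      (b + n%:R) * (poch b n / (n.+1)`!%:R).
    rewrite factS natrM pochS; have f0 := @natr_fact_neq0 R n.+1.
    by field; rewrite f0 -natrD pnatr_eq0.
  by apply: ler_wpM2r; [exact: ltW | rewrite lerD2l ler_nat].
have cb := cvg01_bincoef b0.
have b1 : 0 < b + 1 by lra.
have <- : limn (pseries (primcoef b) z) = z * hypF 1 b 2 z.
  rewrite hypFE; apply/cvg_lim => //; rewrite -cvg_shiftS.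
  rewrite (_ : (fun n => _) = (fun n => z * pseries (hypcoef 1 b 2) z n)).
    by apply: cvgMr; apply: cvg01_hypcoef => //; lra.
  apply/funext => n /=; rewrite /pseries !seriesEnat /= big_nat_recl//= mul0r add0r.
  rewrite mulr_sumr; apply: eq_bigr => i _.
  rewrite /hypcoef poch1 exprS.
  have -> : poch (2 : R) i = (i.+1)`!%:R.
    by rewrite -poch1 poch_recl mul1r; congr (poch _ _); ring.
  by field; rewrite !natr_fact_neq0.
pose D x := limn (pseries (primcoef b) x) - Phi x.
have /andP[z0 z1] := z01.
have E : D z = D 0.
  apply: derive0_constant => // x /andP[x0 xz].
  have x01 : 0 <= x < 1 by rewrite x0 (le_lt_trans xz).
  have h1 : is_derive x (1 : R) (fun x => limn (pseries (primcoef b) x)) ((1 - x) `^ (- b)).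
    rewrite -binomial_series// -dw; apply: is_derive_pseries01 => //; rewrite dw//.
    by rewrite pseries_diffs_bincoef; apply/cvg01Z/cvg01_bincoef.
  by rewrite -(subrr ((1 - x) `^ (- b))); apply: is_deriveB; exact: dPhi.
move: E; rewrite /D limn_pseries0 Phi0 subr0 => /eqP.
by rewrite subr_eq0 => /eqP.
Qed.

Lemma hypF12_log z : 0 <= z < 1 -> z * hypF 1 1 2 z = - ln (1 - z).
Proof.
move=> z01; apply: (@hypF12_primitive 1 (fun x => - ln (1 - x)) z ltr01 z01).
  move=> x /andP[_ x1]; rewrite -(opprK (_ `^ _)).
  have h := is_derive_onem x.
  have g : is_derive (1 - x) (1 : R) (@ln R) (1 - x)^-1.
    by apply: is_derive1_ln; lra.
  apply: is_deriveN.
  have := @is_derive1_comp R (@ln R) (fun s : R => 1 - s) x _ _ g h.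
  by rewrite mulrN1 powR_inv1// subr_ge0 ltW.
by rewrite subr0 ln1 oppr0.
Qed.

Lemma hypF12_power b z : 0 < b -> b != 1 -> 0 <= z < 1 ->
  z * hypF 1 b 2 z = (1 - (1 - z) `^ (1 - b)) / (1 - b).
Proof.
move=> b0 b1 z01.
have b1' : 1 - b != 0 by rewrite subr_eq0 eq_sym.
pose Phi x := (1 - b)^-1 * (1 - (1 - x) `^ (1 - b)).
have -> : (1 - (1 - z) `^ (1 - b)) / (1 - b) = Phi z by rewrite mulrC.
apply: (@hypF12_primitive b Phi z b0 z01).
  move=> x /andP[_ x1].
  have := is_derive_powR_onem (1 - b) x1; rewrite (_ : 1 - b - 1 = - b); last by ring.
  move=> h.
  have h' : is_derive x (1 : R) (fun s => 1 - (1 - s) `^ (1 - b)) ((1 - b) * (1 - x) `^ (- b)).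
    by rewrite -[X in is_derive _ _ _ X]opprK -[X in is_derive _ _ _ X]add0r; apply: is_deriveB.
  rewrite -[X in is_derive _ _ _ X](mulKf b1').
  exact: is_deriveZ.
by rewrite /Phi subr0 powR1 subrr mulr0.
Qed.

Lemma hypF_at0 a b g : hypF a b g 0 = 1.
Proof. by rewrite hypFE limn_pseries0 /hypcoef !poch0 fact0 !divr1 mulr1. Qed.

End HypergeometricValues.

(** * Improper integrals and moments *)

Section OpenIntegral.
Context {R : realType}.
Local Notation mu := (@lebesgue_measure R).

Lemma continuous_measurable_on (D : set R) (f : R -> R) : open D ->
  (forall x, D x -> {for x, continuous f}) -> measurable_fun D f.
Proof.
move=> oD cf; apply: open_continuous_measurable_fun => //.
by move=> x; rewrite inE; exact: cf.
Qed.

Lemma within_segment_continuous (a b : R) (f : R -> R) :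
  (forall x, a <= x <= b -> {for x, continuous f}) ->
  {within `[a, b], continuous f}.
Proof.
move=> cf; apply: continuous_in_subspaceT => x.
by rewrite inE /= in_itv/= => /cf.
Qed.

Lemma FTC2_segment (f Phi : R -> R) (a b : R) : a < b ->
  (forall x, a <= x <= b -> {for x, continuous f}) ->
  (forall x, a <= x <= b -> is_derive x (1 : R) Phi (f x)) ->
  (\int[mu]_(x in `[a, b]) (f x)%:E = (Phi b - Phi a)%:E)%E.
Proof.
move=> ab cf dPhi; rewrite EFinB.
have cPhi x : a <= x <= b -> {for x, continuous Phi}.
  move=> /dPhi h; apply/differentiable_continuous/derivable1_diffP.
  exact: ex_derive.
apply: continuous_FTC2 => //.
- exact: within_segment_continuous.
- split.
  + by move=> x; rewrite in_itv/= => /andP[ax xb]; have h := dPhi x; apply: ex_derive; apply: h; rewrite !ltW.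
  + by apply: cvg_at_right_filter; apply: cPhi; rewrite lexx ltW.
  + by apply: cvg_at_left_filter; apply: cPhi; rewrite lexx ltW.
- move=> x; rewrite in_itv/= => /andP[ax xb]; rewrite derive1E.
  have h : is_derive x (1 : R) Phi (f x) by apply: dPhi; rewrite !ltW.
  by rewrite derive_val.
Qed.

(** The integrands below are smooth inside an open interval but may be singular
    at its ends, so the fundamental theorem of calculus is used on segments that
    fill the interval. *)
Record exhausts (D : set R) (a b : R^nat) : Prop := Exhausts {
  exh_open : open D;
  exh_measurable : measurable D;
  exh_lt : forall m, a m < b m;
  exh_nd : nondecreasing_seq (fun m => `[a m, b m]%classic);
  exh_cup : D = \bigcup_m `[a m, b m]%classic }.

Section Exhaust.
Variables (D : set R) (a b : R^nat).
Hypothesis Dab : exhausts D a b.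

Let sub m x : a m <= x <= b m -> D x.
Proof. by move=> xm; rewrite (exh_cup Dab); exists m => //=; rewrite in_itv. Qed.

Lemma exhausts_cvg (f : R -> R) :
  (forall x, D x -> 0 <= f x) -> (forall x, D x -> {for x, continuous f}) ->
  ((\int[mu]_(x in `[a m, b m]) (f x)%:E) @[m --> \oo] -->
    \int[mu]_(x in D) (f x)%:E)%E.
Proof.
move=> f0 cf; rewrite [in X in _ --> X](exh_cup Dab).
have mf := continuous_measurable_on (exh_open Dab) cf.
have sD m : `[a m, b m] `<=` D by move=> x /=; rewrite in_itv; exact: sub.
apply: ge0_nondecreasing_set_cvg_integral => //.
- exact: (exh_nd Dab).
- move=> m; apply/measurable_EFinP.
  by apply: measurable_funS mf; [exact: (exh_measurable Dab)|exact: sD].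
- by move=> m x /sD Dx; rewrite lee_fin f0.
Qed.

Lemma integral_le_primitive (f Phi : R -> R) (C : R) :
  (forall x, D x -> 0 <= f x) -> (forall x, D x -> {for x, continuous f}) ->
  (forall x, D x -> is_derive x (1 : R) Phi (f x)) ->
  (forall m, Phi (b m) - Phi (a m) <= C) ->
  (\int[mu]_(x in D) (f x)%:E <= C%:E)%E.
Proof.
move=> f0 cf dPhi PhiC; apply: cvge_to_le (exhausts_cvg f0 cf) _.
apply: nearW => m; have -> : (\int[mu]_(x in `[a m, b m]) (f x)%:E = (Phi (b m) - Phi (a m))%:E)%E.
  apply: FTC2_segment; first exact: (exh_lt Dab).
  - by move=> x /sub /cf.
  - by move=> x /sub /dPhi.
by rewrite lee_fin.
Qed.

(** A linear relation between two improper integrals, obtained from a primitive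
    whose boundary terms vanish in the limit. *)
Lemma integral_balance (f g Phi : R -> R) (c1 c2 : R) :
  (forall x, D x -> 0 <= f x) -> (forall x, D x -> {for x, continuous f}) ->
  (forall x, D x -> 0 <= g x) -> (forall x, D x -> {for x, continuous g}) ->
  (\int[mu]_(x in D) (f x)%:E < +oo)%E ->
  (\int[mu]_(x in D) (g x)%:E < +oo)%E ->
  (forall x, D x -> is_derive x (1 : R) Phi (c1 * f x - c2 * g x)) ->
  Phi (b m) - Phi (a m) @[m --> \oo] --> 0 ->
  c1 * \int[mu]_(x in D) f x = c2 * \int[mu]_(x in D) g x.
Proof.
move=> f0 cf g0 cg fy gy dPhi Phi0.
have fin (h : R -> R) : (forall x, D x -> 0 <= h x) ->
    (\int[mu]_(x in D) (h x)%:E < +oo)%E ->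
    (\int[mu]_(x in D) (h x)%:E)%E \is a fin_num.
  by move=> h0 hy; rewrite ge0_fin_numE//; apply: integral_ge0 => x /h0; rewrite lee_fin.
have cvR (h : R -> R) : (forall x, D x -> 0 <= h x) ->
    (forall x, D x -> {for x, continuous h}) ->
    (\int[mu]_(x in D) (h x)%:E < +oo)%E ->
    \int[mu]_(x in `[a m, b m]) h x @[m --> \oo] --> \int[mu]_(x in D) h x.
  move=> h0 ch hy; apply: fine_cvg; rewrite fineK; last exact: fin.
  exact: exhausts_cvg.
apply/eqP; rewrite -subr_eq0; apply/eqP.
have cv1 := cvgB (cvgMr (a := c1) (cvR f f0 cf fy)) (cvgMr (a := c2) (cvR g g0 cg gy)).
rewrite -(cvg_lim _ (cv1 _ _ _))//; apply/cvg_lim => //.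
apply: cvg_trans Phi0; apply: near_eq_cvg; apply: nearW => m.
have int (h : R -> R) : (forall x, D x -> {for x, continuous h}) ->
    mu.-integrable `[a m, b m] (EFin \o h).
  move=> ch; apply: continuous_compact_integrable; first exact: segment_compact.
  by apply: within_segment_continuous => x /sub /ch.
have cZ (k : R) (h : R -> R) : (forall x, D x -> {for x, continuous h}) ->
    forall x, D x -> {for x, continuous (fun x => k * h x)}.
  by move=> ch x /ch hx; apply: cvgMr.
rewrite !fctE /= -!RintegralZl//; [|exact: int..].
rewrite -RintegralB//; [|by apply: int; exact: cZ..].
rewrite /Rintegral.
have -> : (\int[mu]_(x in `[a m, b m]) (c1 * f x - c2 * g x)%:E =
    (Phi (b m) - Phi (a m))%:E)%E.
  apply: FTC2_segment; first exact: (exh_lt Dab).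
  - by move=> x /sub Dx; apply: cvgB; exact: cZ.
  - by move=> x /sub /dPhi.
by [].
Qed.

End Exhaust.

(** The hypothesis on consecutive moments says that under the weight f the
    moment of order n of h is (al)_n / (ga)_n times the total mass.  Integrating
    the binomial series of (1 - z h)^(-be) term by term then produces the
    hypergeometric series. *)
Lemma integral_hyp (D : set R) (f h : R -> R) (al be ga z : R) :
  open D -> measurable D ->
  (forall x, D x -> 0 <= f x) -> (forall x, D x -> {for x, continuous f}) ->
  (forall x, D x -> 0 <= h x < 1) -> (forall x, D x -> {for x, continuous h}) ->
  (\int[mu]_(x in D) (f x)%:E < +oo)%E ->
  0 < al -> 0 < be -> 0 < ga -> 0 <= z < 1 ->
  (forall n, (al + n%:R) * \int[mu]_(x in D) (h x ^+ n * f x) =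
             (ga + n%:R) * \int[mu]_(x in D) (h x ^+ n.+1 * f x)) ->
  \int[mu]_(x in D) ((1 - z * h x) `^ (- be) * f x) =
  hypF be al ga z * \int[mu]_(x in D) f x.
Proof.
move=> oD mD f0 cf h01 ch fy al0 be0 ga0 z01 rec; have /andP[z0 z1] := z01.
have hf0 n x : D x -> 0 <= h x ^+ n * f x.
  by move=> Dx; rewrite mulr_ge0 ?f0// exprn_ge0//; have /andP[] := h01 x Dx.
have chf n x : D x -> {for x, continuous (fun x => h x ^+ n * f x)}.
  move=> Dx; apply: cvgM; last exact: cf.
  elim: n => [|n IH]; first by under eq_fun do rewrite expr0; exact: cvg_cst.
  under eq_fun do rewrite exprS.
  by rewrite exprS; apply: cvgM => //; exact: ch.
have mhf n : measurable_fun D (fun x => (h x ^+ n * f x)%:E).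
  by apply/measurable_EFinP; exact: continuous_measurable_on (chf n).
have mf : measurable_fun D (fun x => (f x)%:E).
  by apply/measurable_EFinP; exact: continuous_measurable_on.
have ffin : (\int[mu]_(x in D) (f x)%:E)%E \is a fin_num.
  by rewrite ge0_fin_numE//; apply: integral_ge0 => x /f0; rewrite lee_fin.
have hffin n : (\int[mu]_(x in D) (h x ^+ n * f x)%:E)%E \is a fin_num.
  rewrite ge0_fin_numE; last by apply: integral_ge0 => x /(hf0 n); rewrite lee_fin.
  apply: le_lt_trans fy; apply: ge0_le_integral => //.
  - by move=> x /(hf0 n); rewrite lee_fin.
  - exact: mhf.
  - move=> x Dx; rewrite lee_fin ler_piMl ?f0//.
    by have /andP[h0 h1] := h01 x Dx; rewrite exprn_ile1// ltW.
set I0 := \int[mu]_(x in D) f x.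
have moment n : \int[mu]_(x in D) (h x ^+ n * f x) = poch al n / poch ga n * I0.
  elim: n => [|n IH].
    rewrite !poch0 divr1 mul1r; apply: eq_Rintegral => x _.
    by rewrite expr0 mul1r.
  have gn : ga + n%:R != 0 by rewrite gt_eqF// ltr_wpDr.
  apply: (mulfI gn); rewrite -rec IH !pochS.
  have h' : poch ga n != 0 by rewrite gt_eqF// poch_gt0.
  by field; rewrite gn h'.
have I0ge0 : 0 <= I0 by apply: Rintegral_ge0.
have key : (\int[mu]_(x in D) ((1 - z * h x) `^ (- be) * f x)%:E =
    \sum_(n <oo) \int[mu]_(x in D) ((bincoef be n * z ^+ n)%:E * (h x ^+ n * f x)%:E))%E.
  rewrite -integral_nneseries//; last 2 first.
  - by move=> n; apply: measurable_funeM; exact: mhf.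
  - move=> n x Dx; rewrite -EFinM lee_fin; apply: mulr_ge0; last exact: hf0.
    by apply: mulr_ge0; [rewrite ltW// bincoef_gt0 | exact: exprn_ge0].
  apply: eq_integral => x; rewrite inE => Dx.
  have /andP[h0 h1] := h01 x Dx.
  have zh01 : 0 <= z * h x < 1.
    rewrite mulr_ge0//=; apply: le_lt_trans h1; rewrite ler_piMl// ltW//.
  rewrite -binomial_series// mulrC EFinM -pseries_ereal//; last exact: cvg01_bincoef.
  rewrite -nneseriesZl; last first.
    move=> n _; rewrite lee_fin; apply: mulr_ge0; last by apply: exprn_ge0; have /andP[] := zh01.
    by rewrite ltW// bincoef_gt0.
  by apply: eq_eseriesr => n _; rewrite -!EFinM exprMn; congr EFin; ring.
rewrite {1}/Rintegral key.
rewrite (_ : (\sum_(n <oo) _)%E = (I0 * hypF be al ga z)%:E) /=; first by rewrite mulrC.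
rewrite EFinM hypFE -pseries_ereal//; last exact: cvg01_hypcoef.
rewrite -nneseriesZl; last first.
  move=> n _; rewrite lee_fin; apply: mulr_ge0; last exact: exprn_ge0.
  by rewrite ltW// hypcoef_gt0.
apply: eq_eseriesr => n _.
rewrite ge0_integralZl//; last 3 first.
- exact: mhf.
- by move=> x /(hf0 n); rewrite lee_fin.
- by rewrite lee_fin; apply: mulr_ge0; [rewrite ltW// bincoef_gt0 | exact: exprn_ge0].
rewrite -(fineK (hffin n)) -/(Rintegral mu D (fun x => h x ^+ n * f x)) moment -!EFinM.
rewrite /bincoef /hypcoef; congr EFin.
have h' : poch ga n != 0 by rewrite gt_eqF// poch_gt0.
by field; rewrite h' natr_fact_neq0.
Qed.

End OpenIntegral.

(** * Derivatives and integrals of powers *)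

Section PowerCalculus.
Context {R : realType}.
Local Notation mu := (@lebesgue_measure R).

Lemma is_derive_continuous (f : R -> R) x df :
  is_derive x (1 : R) f df -> {for x, continuous f}.
Proof.
by move=> h; apply/differentiable_continuous/derivable1_diffP; exact: ex_derive.
Qed.

(** A continuous positive function is bounded below on the first segment of the
    exhaustion. *)
Lemma Rintegral_gt0 (D : set R) (a b : R^nat) (f : R -> R) : exhausts D a b ->
  (forall x, D x -> 0 < f x) -> (forall x, D x -> {for x, continuous f}) ->
  (\int[mu]_(x in D) (f x)%:E < +oo)%E -> 0 < \int[mu]_(x in D) f x.
Proof.
move=> Dab f0 cf fy; set u := a 0%N; set v := b 0%N.
have uv : u < v by exact: (exh_lt Dab).
have sub x : u <= x <= v -> D x.
  by move=> xm; rewrite (exh_cup Dab); exists 0%N => //=; rewrite in_itv.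
have cs : {within `[u, v], continuous f}.
  by apply: within_segment_continuous => x /sub /cf.
have [c cuv cmin] := EVT_min (ltW uv) cs.
have fc0 : 0 < f c by apply: f0; apply: sub; rewrite in_itv in cuv.
have D0 : (\int[mu]_(x in D) (f x)%:E)%E \is a fin_num.
  by rewrite ge0_fin_numE//; apply: integral_ge0 => x /f0; rewrite lee_fin => /ltW.
rewrite -lte_fin fineK//.
have mD : measurable_fun D (fun x => (f x)%:E).
  by apply/measurable_EFinP; exact: continuous_measurable_on (exh_open Dab) cf.
have sD : `[u, v]%classic `<=` D by move=> x /=; rewrite in_itv; exact: sub.
apply: (@lt_le_trans _ _ (\int[mu]_(x in `[u, v]) (f x)%:E)%E); last first.
  apply: ge0_subset_integral => //; first exact: (exh_measurable Dab).
  by move=> x /f0; rewrite lee_fin => /ltW.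
apply: (@lt_le_trans _ _ (\int[mu]_(x in `[u, v]) (cst (f c)%:E) x)%E).
  rewrite integral_cst//= lebesgue_measure_itv/= lte_fin uv -EFinB -EFinM lte_fin.
  by rewrite mulr_gt0// subr_gt0.
apply: ge0_le_integral => //.
- by move=> x _; rewrite lee_fin ltW.
- by apply: measurable_funS mD => //; exact: (exh_measurable Dab).
Qed.

Lemma is_derive_powR_comp (y : R -> R) (x y' e : R) : 0 < y x ->
  is_derive x (1 : R) y y' ->
  is_derive x (1 : R) (fun t => y t `^ e) (e * y x `^ (e - 1) * y').
Proof.
move=> y0 h; have g := is_derive1_powR e y0.
exact: (@is_derive1_comp R (@powR R ^~ e) y x _ _ g h).
Qed.

Lemma is_derive_add1_powR (p x : R) : 0 < x ->
  is_derive x (1 : R) (fun t => 1 + t `^ p) (p * x `^ (p - 1)).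
Proof.
move=> x0; have g := is_derive1_powR p x0.
by rewrite -[X in is_derive _ _ _ X]add0r; apply: is_deriveD.
Qed.

Lemma is_derive_sub1_powR (p x : R) : 0 < x ->
  is_derive x (1 : R) (fun t => 1 - t `^ p) (- (p * x `^ (p - 1))).
Proof.
move=> x0; have g := is_derive1_powR p x0.
by rewrite -[X in is_derive _ _ _ X]add0r; apply: is_deriveB.
Qed.

Lemma powR_invXn (y c : R) n : 0 < y ->
  y^-1 ^+ n * y `^ (- c) = y `^ (- (c + n%:R)).
Proof.
move=> y0; rewrite opprD addrC powRD; last by rewrite (gt_eqF y0) implybT.
by rewrite exprVn powR_invn// ltW.
Qed.

Lemma powR_pinvK (p x : R) : 0 < p -> 0 <= x -> (x `^ p) `^ p^-1 = x.
Proof. by move=> p0 x0; rewrite -powRrM mulfV ?gt_eqF// powRr1. Qed.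

Lemma powR_invpK (p x : R) : 0 < p -> 0 <= x -> (x `^ p^-1) `^ p = x.
Proof. by move=> p0 x0; rewrite -powRrM mulVf ?gt_eqF// powRr1. Qed.

Lemma onem_powR (p x : R) : 0 < p -> 0 < x <= 1 -> 0 <= 1 - x `^ p < 1.
Proof.
move=> p0 /andP[x0 x1]; have xp0 : 0 < x `^ p by exact: powR_gt0.
have xp1 : x `^ p <= 1.
  apply: (@le_trans _ _ (1 `^ p)); last by rewrite powR1.
  by apply: ge0_ler_powR; rewrite ?nnegrE ?(ltW p0) ?(ltW x0).
by apply/andP; split; lra.
Qed.

Lemma diff_bound (c u v w : R) : 0 <= c -> 0 <= u <= w -> 0 <= v <= w ->
  - (c * w) <= c * u - c * v <= c * w.
Proof.
move=> c0 /andP[u0 uw] /andP[v0 vw].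
have := ler_wpM2l c0 uw; have := ler_wpM2l c0 vw.
have := mulr_ge0 c0 u0; have := mulr_ge0 c0 v0.
by move=> *; apply/andP; split; lra.
Qed.

End PowerCalculus.

(** * The integral over the half line *)

Section HalfLine.
Context {R : realType}.
Local Notation mu := (@lebesgue_measure R).
Variable p : R.
Hypothesis p0 : 0 < p.

Let f (t : R) := (1 + t `^ p) `^ (- (2 / p)).
Let h (t : R) := (1 + t `^ p)^-1.
Let D : set R := `]0, +oo[.

Lemma exhausts_halfline :
  exhausts (`]0, +oo[%classic : set R) (fun m => m.+2%:R^-1) (fun m => m.+2%:R).
Proof.
split.
- exact: interval_open.
- exact: measurable_itv.
- move=> m; apply: (@lt_trans _ _ 1); last by rewrite ltr1n.
  by rewrite invf_lt1 ?ltr1n.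
- move=> m n mn; apply/subsetPset => x /=; rewrite !in_itv/= => /andP[h1 h2].
  apply/andP; split; last by rewrite (le_trans h2)// ler_nat !ltnS.
  by rewrite (le_trans _ h1)// lef_pV2 ?posrE ?ler_nat ?ltr0n// !ltnS.
- apply/seteqP; split => x /=.
    rewrite in_itv/= andbT => x0.
    pose m := Num.bound (x + x^-1).
    have xm : x + x^-1 < m.+2%:R.
      apply: (@lt_le_trans _ _ m%:R); last by rewrite ler_nat ltnW.
      by rewrite archi_boundP// addr_ge0// ?invr_ge0 ltW.
    exists m => //=; rewrite in_itv/=; apply/andP; split.
      rewrite -[leRHS]invrK lef_pV2 ?posrE ?invr_gt0 ?ltr0n//.
      by rewrite (le_trans _ (ltW xm))// lerDr ltW.
    by rewrite (le_trans _ (ltW xm))// lerDl invr_ge0 ltW.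
  by move=> [m _] /=; rewrite !in_itv/= andbT => /andP[+ _]; apply: lt_le_trans.
Qed.

Let Dgt0 t : D t -> 0 < t. Proof. by rewrite /D /= in_itv/= andbT. Qed.

Let y_gt0 t : 0 < 1 + t `^ p.
Proof. by rewrite ltr_pwDl// powR_ge0. Qed.

Let f_gt0 t : 0 < f t. Proof. exact: powR_gt0. Qed.

Let cf t : D t -> {for t, continuous f}.
Proof.
move=> /Dgt0 t0; apply: is_derive_continuous.
exact: is_derive_powR_comp (is_derive_add1_powR p t0).
Qed.

Let ch t : D t -> {for t, continuous h}.
Proof.
move=> /Dgt0 t0; apply: continuousV; first by rewrite gt_eqF.
exact: is_derive_continuous (is_derive_add1_powR p t0).
Qed.

(** (1 + t)^p <= (2 max(1, t))^p <= 2^p (1 + t^p) *)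
Let f_le t : D t -> f t <= 4 * (1 + t) `^ (- 2).
Proof.
move=> /Dgt0 t0; have y0 := y_gt0 t.
rewrite /f (_ : - (2 / p) = p^-1 * (- 2)); last by ring.
rewrite powRrM !powRN.
have t10 : 0 < 1 + t by lra.
have Y0 : 0 < (1 + t `^ p) `^ p^-1 by rewrite powR_gt0.
rewrite !(@powR_mulrn _ _ 2) ?(ltW t10) ?(ltW Y0)//.
have key : 1 + t <= 2 * (1 + t `^ p) `^ p^-1.
  have h1 : 1 <= (1 + t `^ p) `^ p^-1.
    apply: (@le_trans _ _ (1 `^ p^-1)); first by rewrite powR1.
    apply: ge0_ler_powR; rewrite ?nnegrE ?invr_ge0 ?(ltW p0) ?(ltW y0)//.
    by rewrite lerDl powR_ge0.
  have h2 : t <= (1 + t `^ p) `^ p^-1.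
    rewrite -[leLHS](powR_pinvK p0 (ltW t0)); apply: ge0_ler_powR; rewrite ?nnegrE ?invr_ge0 ?powR_ge0 ?(ltW p0) ?(ltW y0)//.
    by rewrite lerDr.
  lra.
rewrite ler_pdivlMr ?exprn_gt0// mulrC ler_pdivrMr ?exprn_gt0//.
rewrite (_ : 4 * _ = (2 * (1 + t `^ p) `^ p^-1) ^+ 2); last by ring.
by rewrite lerXn2r ?nnegrE ?mulr_ge0 ?(ltW t10) ?(ltW Y0).
Qed.

Let f_fin : (\int[mu]_(t in D) (f t)%:E < +oo)%E.
Proof.
have dPhi x : D x -> is_derive x (1 : R) (fun t => - 4 * (1 + t) `^ (- 1)) (4 * (1 + x) `^ (- 2)).
  move=> /Dgt0 x0.
  have h1 : is_derive x (1 : R) (fun t : R => 1 + t) 1.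
    by rewrite -[X in is_derive _ _ _ X]add0r; apply: is_deriveD.
  have x1 : 0 < 1 + x by lra.
  have := is_deriveZ (- 4) (is_derive_powR_comp (- 1) x1 h1).
  move=> /is_derive_eq; apply; rewrite /GRing.scale /= mulr1.
  rewrite (_ : -1 - 1 = -2); ring.
have cg (x : R) : D x -> {for x, continuous (fun t : R => 4 * (1 + t) `^ (- 2))}.
  move=> /Dgt0 x0; apply: cvgMr.
  have h1 : is_derive x (1 : R) (fun t : R => 1 + t) 1.
    by rewrite -[X in is_derive _ _ _ X]add0r; apply: is_deriveD.
  have x1 : 0 < 1 + x by lra.
  exact: is_derive_continuous (is_derive_powR_comp (- 2) x1 h1).
have g0 (x : R) : D x -> 0 <= 4 * (1 + x) `^ (- 2) by rewrite mulr_ge0 ?powR_ge0.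
have := integral_le_primitive (C := 4) exhausts_halfline g0 cg dPhi.
move=> le4; apply: le_lt_trans (ltry 4); apply: le_trans (le4 _); last first.
  move=> m; have h1 : 0 <= (1 + m.+2%:R) `^ (-1) :> R by exact: powR_ge0.
  have h2 : (1 + m.+2%:R^-1) `^ (-1) <= 1 :> R.
    by rewrite powR_inv1 ?addr_ge0// invf_le1 ?lerDl// ltr_pwDl.
  lra.
apply: ge0_le_integral => //.
- exact: measurable_itv.
- by move=> x _; rewrite lee_fin ltW.
- by apply/measurable_EFinP; exact: continuous_measurable_on (exh_open exhausts_halfline) cf.
- by apply/measurable_EFinP; exact: continuous_measurable_on (exh_open exhausts_halfline) cg.
Qed.

Lemma halfline_gt0 : 0 < \int[mu]_(t in `]0, +oo[) ((1 + t `^ p) `^ (- (2 / p))).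
Proof. exact: Rintegral_gt0 exhausts_halfline _ cf f_fin. Qed.

Let h01 t : D t -> 0 <= h t < 1.
Proof.
move=> /Dgt0 t0; rewrite invr_ge0 ltW//=.
by rewrite invf_lt1// ltrDl powR_gt0.
Qed.

Let hfE n t : h t ^+ n * f t = (1 + t `^ p) `^ (- (2 / p + n%:R)).
Proof. exact: powR_invXn. Qed.

Let rec n : (p^-1 + n%:R) * \int[mu]_(t in D) (h t ^+ n * f t) =
            (2 / p + n%:R) * \int[mu]_(t in D) (h t ^+ n.+1 * f t).
Proof.
pose s := 2 / p + n%:R.
have hf0 k t : D t -> 0 <= h t ^+ k * f t by rewrite hfE powR_ge0.
have chf k (t : R) : D t -> {for t, continuous (fun t : R => h t ^+ k * f t)}.
  move=> /Dgt0 t0.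
  rewrite (_ : (fun t : R => _) = (fun t => (1 + t `^ p) `^ (- (2 / p + k%:R)))); last first.
    by apply/funext => u; exact: hfE.
  apply: is_derive_continuous.
  exact: is_derive_powR_comp (is_derive_add1_powR p t0).
have hffin k : (\int[mu]_(t in D) (h t ^+ k * f t)%:E < +oo)%E.
  apply: le_lt_trans f_fin; apply: ge0_le_integral => //.
  - exact: measurable_itv.
  - by move=> x Dx; rewrite lee_fin hf0.
  - by apply/measurable_EFinP; exact: continuous_measurable_on (exh_open exhausts_halfline) (chf k).
  - by apply/measurable_EFinP; exact: continuous_measurable_on (exh_open exhausts_halfline) cf.
  - move=> x Dx; rewrite lee_fin ler_piMl ?(ltW (f_gt0 x))//.
    by have /andP[h0 h1] := h01 Dx; rewrite exprn_ile1 ?(ltW h1).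
(* Phi is at most t / p near 0 and at most 1 / (p t) at infinity. *)
pose Phi t := p^-1 * (t * (1 + t `^ p) `^ (- s)).
apply/esym; apply: (@integral_balance _ D _ _ exhausts_halfline _ _ Phi _ _
  (hf0 n.+1) (chf n.+1) (hf0 n) (chf n) (hffin n.+1) (hffin n)).
  move=> x /Dgt0 x0.
  have d1 := @is_derive_powR_comp R (fun t => 1 + t `^ p) x _ (- s) (y_gt0 x) (is_derive_add1_powR p x0).
  have := is_deriveZ p^-1 (is_deriveM (is_derive_id x (1 : R)) d1).
  move=> /is_derive_eq; apply; rewrite /GRing.scale /= !hfE -/s.
  rewrite -(natr1 n) addrA -/s (opprD s 1).
  have e1 : x * x `^ (p - 1) = x `^ p by rewrite mulr_powRB1// ltW.
  have e2 : (1 + x `^ p) `^ (- s) = (1 + x `^ p) * (1 + x `^ p) `^ (- s - 1).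
    rewrite -[in X in _ = X * _](powRr1 (ltW (y_gt0 x))) -powRD.
      by congr (_ `^ _); ring.
    by rewrite (gt_eqF (y_gt0 x)) implybT.
  set Y := _ `^ (- s - 1) in e2 *. rewrite e2.
  rewrite (_ : x * (- s * Y * (p * x `^ (p - 1))) = - s * Y * p * (x * x `^ (p - 1))); last by ring.
  by rewrite e1 /s; field; rewrite gt_eqF.
have s2 : 2 / p <= s by rewrite lerDl.
have bnd0 x : 0 < x -> 0 <= x * (1 + x `^ p) `^ (- s).
  by move=> x0; rewrite mulr_ge0 ?powR_ge0// ltW.
have bnd1 x : 0 < x -> x * (1 + x `^ p) `^ (- s) <= x.
  move=> x0; rewrite ler_piMr ?(ltW x0)// -[leRHS](powRr0 (1 + x `^ p)).
  apply: ler_powR; first by rewrite lerDl powR_ge0.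
  by rewrite oppr_le0 (le_trans _ s2)// divr_ge0 ?ltW.
have bnd2 x : 0 < x -> x * (1 + x `^ p) `^ (- s) <= x^-1.
  move=> x0; rewrite -ler_pdivlMl//.
  apply: (@le_trans _ _ ((1 + x `^ p) `^ (- (2 / p)))).
    by apply: ler_powR; [rewrite lerDl powR_ge0|rewrite lerN2].
  rewrite powRN -invfM lef_pV2 ?posrE ?powR_gt0 ?mulr_gt0//.
  rewrite [2 / p]mulrC powRrM powR_mulrn ?powR_ge0// -expr2.
  rewrite lerXn2r ?nnegrE ?powR_ge0 ?(ltW x0)//.
  rewrite -[leLHS](powR_pinvK p0 (ltW x0)).
  apply: ge0_ler_powR; rewrite ?nnegrE ?invr_ge0 ?powR_ge0 ?(ltW p0) ?(ltW (y_gt0 x))//.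
  by rewrite lerDr.
have hlim : p^-1 * m.+2%:R^-1 @[m --> \oo] --> (0 : R).
  rewrite -(mulr0 p^-1); apply: cvgMr.
  by rewrite (cvg_shiftS (@harmonic R)); exact: cvg_harmonic.
have hlimN : - (p^-1 * m.+2%:R^-1) @[m --> \oo] --> (0 : R).
  by rewrite -oppr0; exact: cvgN.
apply: squeeze_cvgr hlimN hlim; apply: nearW => m.
have m0 : (0 : R) < m.+2%:R by [].
have mi0 : (0 : R) < m.+2%:R^-1 by rewrite invr_gt0.
have pi0 : 0 <= p^-1 by rewrite invr_ge0 ltW.
have bndm : 0 <= m.+2%:R * (1 + m.+2%:R `^ p) `^ (- s) <= m.+2%:R^-1.
  by apply/andP; split; [exact: bnd0 m0|exact: bnd2 m0].
have bndim : 0 <= m.+2%:R^-1 * (1 + m.+2%:R^-1 `^ p) `^ (- s) <= m.+2%:R^-1.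
  by apply/andP; split; [exact: bnd0 mi0|exact: bnd1 mi0].
exact: diff_bound pi0 bndm bndim.
Qed.

Lemma halfline_hypF z : 0 <= z < 1 ->
  \int[mu]_(t in `]0, +oo[) ((1 - z / (1 + t `^ p)) `^ (- p^-1) * (1 + t `^ p) `^ (- (2 / p))) =
  hypF p^-1 p^-1 (2 / p) z * \int[mu]_(t in `]0, +oo[) ((1 + t `^ p) `^ (- (2 / p))).
Proof.
move=> z01; have pi0 : 0 < p^-1 by rewrite invr_gt0.
apply: (@integral_hyp R D f h p^-1 p^-1 (2 / p) z) => //.
- exact: measurable_itv.
- by move=> x _; rewrite ltW.
- by rewrite divr_gt0.
Qed.

End HalfLine.

(** * The integral over the unit interval *)

Section UnitInterval.
Context {R : realType}.
Local Notation mu := (@lebesgue_measure R).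
Variable p : R.
Hypothesis p0 : 0 < p.

Let f (t : R) := (1 - t `^ p) `^ (p^-1 - 1).
Let h (t : R) := t `^ p.
Let D : set R := `]0, 1[.

(** The ends are chosen through their p-th powers eps and 1 - eps, because the
   boundary terms are functions of t `^ p; eps < 1/2 keeps lo below hi. *)
Let eps (m : nat) : R := m.+3%:R^-1.
Let lo (m : nat) : R := eps m `^ p^-1.
Let hi (m : nat) : R := (1 - eps m) `^ p^-1.

Let pi0 : 0 < p^-1. Proof. by rewrite invr_gt0. Qed.

Let eps0 m : 0 < eps m < 2^-1.
Proof. by rewrite /eps invr_gt0 ltr0n/= ltf_pV2 ?posrE ?ltr0n// ltr_nat. Qed.

Let powp_mono (x y : R) : 0 <= x -> 0 <= y -> (x `^ p <= y `^ p) = (x <= y).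
Proof.
move=> x0 y0; apply/idP/idP => xy; last by rewrite ge0_ler_powR ?nnegrE ?(ltW p0).
by rewrite -(powR_pinvK p0 x0) -(powR_pinvK p0 y0) ge0_ler_powR ?nnegrE ?powR_ge0 ?(ltW pi0).
Qed.

Let loP m : lo m `^ p = eps m.
Proof. by rewrite powR_invpK//; have /andP[/ltW] := eps0 m. Qed.

Let hiP m : hi m `^ p = 1 - eps m.
Proof. by rewrite powR_invpK//; have := eps0 m; lra. Qed.

Let one_powR (c : R) : 1 `^ c = 1. Proof. by rewrite powR1. Qed.

Let pow_lt1 (t : R) : 0 < t < 1 -> t `^ p < 1.
Proof.
move=> /andP[t0 t1]; rewrite -[ltRHS](one_powR p).
by apply: gt0_ltr_powR; rewrite ?nnegrE ?(ltW t0).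
Qed.

Let exhausts_unit_interval : exhausts D lo hi.
Proof.
have inab m x : (x \in `[lo m, hi m]) = (0 <= x) && (eps m <= x `^ p <= 1 - eps m).
  rewrite in_itv/=; have [x0|x0] := leP 0 x.
    by rewrite -(@powp_mono (lo m) x) ?powR_ge0// -(@powp_mono x (hi m)) ?powR_ge0// loP hiP.
  by apply/negbTE; rewrite negb_and -!ltNge (lt_le_trans x0)// powR_ge0.
split.
- exact: interval_open.
- exact: measurable_itv.
- move=> m; rewrite ltNge -(@powp_mono (hi m) (lo m)) ?powR_ge0// -ltNge loP hiP.
  by have := eps0 m; lra.
- move=> m n mn; apply/subsetPset => x.
  rewrite /= !inab => /andP[-> /=].
  have : eps n <= eps m by rewrite /eps lef_pV2 ?posrE ?ltr0n// ler_nat !ltnS.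
  by move=> nm /andP[h1 h2]; apply/andP; split; lra.
- apply/seteqP; split => x; rewrite /D /=.
    rewrite in_itv/= => x01; have /andP[x0 x1] := x01.
    have xp1 := pow_lt1 x01; have xp0 : 0 < x `^ p by rewrite powR_gt0.
    pose e := Num.min (x `^ p) (1 - x `^ p).
    have e0 : 0 < e by rewrite lt_min xp0/=; lra.
    pose m := Num.bound e^-1.
    have em : eps m <= e.
      rewrite /eps -[leRHS]invrK lef_pV2 ?posrE ?invr_gt0 ?ltr0n//.
      apply: (@le_trans _ _ m%:R); last by rewrite ler_nat -addn3 leq_addr.
      by rewrite ltW// archi_boundP// invr_ge0 ltW.
    exists m => //; rewrite /= inab (ltW x0)/=.
    by move: em; rewrite /e le_min => /andP[h1 h2]; apply/andP; split; lra.
  move=> [m _]; rewrite /= inab => /andP[x0 /andP[h1 h2]].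
  have /andP[e0 e1] := eps0 m.
  have xp0 : 0 < x `^ p by lra.
  have xgt0 : 0 < x by exact: gt0_powR xp0.
  rewrite in_itv/= xgt0 ltNge; apply/negP => x1.
  have : 1 <= x `^ p by rewrite -[leLHS](one_powR p) powp_mono// ltW.
  lra.
Qed.

Let D01 t : D t -> 0 < t < 1. Proof. by rewrite /D /= in_itv. Qed.

Let y_gt0 t : D t -> 0 < 1 - t `^ p.
Proof. by move=> /D01 /pow_lt1; rewrite subr_gt0. Qed.

Let f_gt0 t : D t -> 0 < f t.
Proof. by move=> /y_gt0 y0; exact: powR_gt0. Qed.

Let cf t : D t -> {for t, continuous f}.
Proof.
move=> Dt; have /andP[t0 _] := D01 Dt; apply: is_derive_continuous.
exact: (@is_derive_powR_comp R (fun t => 1 - t `^ p) _ _ _ (y_gt0 Dt) (is_derive_sub1_powR p t0)).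
Qed.

Let ch t : D t -> {for t, continuous h}.
Proof.
by move=> /D01 /andP[t0 _]; exact: is_derive_continuous (is_derive1_powR p t0).
Qed.

Let h01 t : D t -> 0 <= h t < 1.
Proof. by move=> /D01 t01; rewrite powR_ge0 pow_lt1. Qed.

(** The exponent is nonnegative for p <= 1; for p > 1 the singularity at 1 is
   compared with that of (1 - t)^(1/p - 1), using t^p <= t. *)
Let f_le t : D t -> f t <= 1 + (1 - t) `^ (p^-1 - 1).
Proof.
move=> Dt; have /andP[t0 t1] := D01 Dt; have y0 := y_gt0 Dt.
have tp0 : 0 <= t `^ p by exact: powR_ge0.
rewrite /f; have [p1|p1] := leP p 1.
  apply: (@le_trans _ _ 1); last by rewrite lerDl powR_ge0.
  rewrite -[leRHS](powRr0 (1 - t `^ p)); apply: ger_powR.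
    by rewrite y0 gerBl.
  by rewrite subr_ge0 invf_ge1.
apply: (@le_trans _ _ ((1 - t) `^ (p^-1 - 1))); last by rewrite lerDr.
have e : p^-1 - 1 = - (1 - p^-1) by ring.
rewrite e !powRN lef_pV2 ?posrE ?powR_gt0//; last by lra.
have pi1 : 0 <= 1 - p^-1 by rewrite subr_ge0 invf_le1// ltW.
rewrite ge0_ler_powR// ?nnegrE ?(ltW y0)//; first by lra.
by rewrite lerD2l lerN2 ge1r_powR ?t0 ?(ltW t1) ?(ltW p1).
Qed.

Let f_fin : (\int[mu]_(t in D) (f t)%:E < +oo)%E.
Proof.
have aux (u v w x : R) : 0 < w -> u < 1 -> 0 <= v -> x <= p ->
  u - v - (w - x) <= 1 + p by move=> *; lra.
have d1m := @is_derive_onem R.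
have dPhi (x : R) : D x -> is_derive x (1 : R)
    (fun t : R => t - p * (1 - t) `^ p^-1) (1 + (1 - x) `^ (p^-1 - 1)).
  move=> /D01 /andP[x0 x1]; have y0 : 0 < 1 - x by lra.
  have := is_deriveB (is_derive_id x (1 : R)) (is_deriveZ p (@is_derive_powR_comp R (fun t => 1 - t) x _ p^-1 y0 (d1m x))).
  move=> /is_derive_eq; apply; rewrite /GRing.scale /=.
  by field; rewrite gt_eqF.
have cg (x : R) : D x -> {for x, continuous (fun t : R => 1 + (1 - t) `^ (p^-1 - 1))}.
  move=> /D01 /andP[x0 x1]; have y0 : 0 < 1 - x by lra.
  apply: cvgD; first exact: cvg_cst.
  exact: is_derive_continuous (@is_derive_powR_comp R (fun t => 1 - t) x _ (p^-1 - 1) y0 (d1m x)).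
have g0 (x : R) : D x -> 0 <= 1 + (1 - x) `^ (p^-1 - 1) by rewrite addr_ge0 ?powR_ge0.
have := integral_le_primitive (C := 1 + p) exhausts_unit_interval g0 cg dPhi.
move=> le4; apply: le_lt_trans (ltry (1 + p)); apply: le_trans (le4 _); last first.
  move=> m.
  have sub01 x : x \in `[lo m, hi m] -> 0 < x < 1.
    move=> xm; suff : D x by exact: D01.
    by rewrite (exh_cup exhausts_unit_interval); exists m.
  have lohi : lo m < hi m by exact: exh_lt exhausts_unit_interval m.
  have /andP[l0 l1] : 0 < lo m < 1 by apply: sub01; rewrite in_itv/= lexx ltW.
  have /andP[h0 h1] : 0 < hi m < 1 by apply: sub01; rewrite in_itv/= lexx ltW.
  have a1 : 0 <= p * (1 - hi m) `^ p^-1 by rewrite mulr_ge0 ?powR_ge0// ltW.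
  have a2 : p * (1 - lo m) `^ p^-1 <= p.
    rewrite ler_piMr ?(ltW p0)// -[leRHS](one_powR p^-1).
    by apply: ge0_ler_powR; rewrite ?nnegrE ?(ltW pi0)//; lra.
  exact: aux.
apply: ge0_le_integral => //.
- exact: measurable_itv.
- by move=> x Dx; rewrite lee_fin ltW// f_gt0.
- by apply/measurable_EFinP; exact: continuous_measurable_on (exh_open exhausts_unit_interval) cf.
- by apply/measurable_EFinP; exact: continuous_measurable_on (exh_open exhausts_unit_interval) cg.
Qed.

Lemma unit_interval_gt0 : 0 < \int[mu]_(t in `]0, 1[) ((1 - t `^ p) `^ (p^-1 - 1)).
Proof. exact: Rintegral_gt0 exhausts_unit_interval f_gt0 cf f_fin. Qed.

Let rec n : (p^-1 + n%:R) * \int[mu]_(t in D) (h t ^+ n * f t) =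
            (2 / p + n%:R) * \int[mu]_(t in D) (h t ^+ n.+1 * f t).
Proof.
have hf0 k t : D t -> 0 <= h t ^+ k * f t.
  by move=> Dt; apply: mulr_ge0; [apply: exprn_ge0; exact: powR_ge0|exact: powR_ge0].
have chf k (t : R) : D t -> {for t, continuous (fun t : R => h t ^+ k * f t)}.
  move=> Dt; apply: cvgM; last exact: cf.
  elim: k => [|k IH]; first by under eq_fun do rewrite expr0; exact: cvg_cst.
  under eq_fun do rewrite exprS.
  by rewrite exprS; apply: cvgM => //; exact: ch.
have hffin k : (\int[mu]_(t in D) (h t ^+ k * f t)%:E < +oo)%E.
  apply: le_lt_trans f_fin; apply: ge0_le_integral => //.
  - exact: measurable_itv.
  - by move=> x Dx; rewrite lee_fin hf0.
  - by apply/measurable_EFinP; exact: continuous_measurable_on (exh_open exhausts_unit_interval) (chf k).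
  - by apply/measurable_EFinP; exact: continuous_measurable_on (exh_open exhausts_unit_interval) cf.
  - move=> x Dx; rewrite lee_fin ler_piMl ?(ltW (f_gt0 Dx))//.
    by have /andP[h0 h1] := h01 Dx; rewrite exprn_ile1 ?(ltW h1).
pose e := p * n%:R + 1.
pose Phi (t : R) := p^-1 * (t `^ e * (1 - t `^ p) `^ p^-1).
apply: (@integral_balance _ D _ _ exhausts_unit_interval _ _ Phi _ _
  (hf0 n) (chf n) (hf0 n.+1) (chf n.+1) (hffin n) (hffin n.+1)).
  move=> x Dx; have /andP[x0 x1] := D01 Dx; have y0 := y_gt0 Dx.
  have d1 := @is_derive_powR_comp R (fun t => 1 - t `^ p) x _ p^-1 y0 (is_derive_sub1_powR p x0).
  have := is_deriveZ p^-1 (is_deriveM (is_derive1_powR e x0) d1).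
  move=> /is_derive_eq; apply; rewrite /GRing.scale /= /h /f.
  have e1 : x * x `^ (p - 1) = x `^ p by rewrite mulr_powRB1// ltW.
  have e2 : (1 - x `^ p) `^ p^-1 = (1 - x `^ p) * (1 - x `^ p) `^ (p^-1 - 1).
    by rewrite mulr_powRB1 ?(ltW y0).
  have e3 : x `^ (e - 1) = x `^ p ^+ n.
    by rewrite /e addrK powRrM powR_mulrn ?powR_ge0.
  have e4 : x `^ e = x * x `^ p ^+ n.
    by rewrite -e3 mulr_powRB1 ?(ltW x0)// ltr_wpDl// mulr_ge0 ?(ltW p0).
  rewrite e2 e3 e4 exprS; set Y := _ `^ (p^-1 - 1); set H := _ ^+ n.
  rewrite (_ : x * H * (p^-1 * Y * - (p * x `^ (p - 1))) = - (H * (p^-1 * Y) * p * (x * x `^ (p - 1)))); last by ring.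
  by rewrite e1 /e; field; rewrite gt_eqF.
have hlim : p^-1 * (eps m `^ p^-1) @[m --> \oo] --> (0 : R).
  rewrite -(mulr0 p^-1); apply: cvgMr.
  have /cvg_at_rightP := powR_cvg0 pi0; apply; split.
    by move=> m; have /andP[] := eps0 m.
  have := @cvg_harmonic R; rewrite -cvg_shiftS -cvg_shiftS; exact.
have hlimN : - (p^-1 * (eps m `^ p^-1)) @[m --> \oo] --> (0 : R).
  by rewrite -oppr0; exact: cvgN.
apply: squeeze_cvgr hlimN hlim; apply: nearW => m.
have /andP[m0 m1] := eps0 m.
have en0 : 0 <= e by rewrite addr_ge0 ?mulr_ge0 ?(ltW p0).
have en1 : 1 <= e by rewrite lerDr mulr_ge0 ?(ltW p0).
have pow_le1 (x c : R) : 0 <= x <= 1 -> 0 <= c -> x `^ c <= 1.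
  move=> /andP[x0 x1] c0; rewrite -[leRHS](one_powR c).
  by apply: ge0_ler_powR; rewrite ?nnegrE.
have A : 0 <= hi m `^ e * (1 - hi m `^ p) `^ p^-1 <= lo m.
  rewrite mulr_ge0 ?powR_ge0//= hiP subKr ler_piMl ?powR_ge0//.
  by apply: (pow_le1 _ e) => //; rewrite powR_ge0/= pow_le1 ?(ltW pi0)//; lra.
have B : 0 <= lo m `^ e * (1 - lo m `^ p) `^ p^-1 <= lo m.
  rewrite mulr_ge0 ?powR_ge0//= loP.
  have l1 : lo m <= 1 by rewrite pow_le1 ?(ltW pi0)//; lra.
  have lgt0 : 0 < lo m by rewrite powR_gt0.
  apply: (@le_trans _ _ (lo m `^ e)).
    by rewrite ler_piMr ?powR_ge0// pow_le1 ?(ltW pi0)//; lra.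
  by rewrite ge1r_powR// lgt0.
exact: diff_bound (ltW pi0) A B.
Qed.

Lemma unit_interval_hypF z : 0 <= z < 1 ->
  \int[mu]_(t in `]0, 1[) ((1 - z * t `^ p) `^ (- p^-1) * (1 - t `^ p) `^ (p^-1 - 1)) =
  hypF p^-1 p^-1 (2 / p) z * \int[mu]_(t in `]0, 1[) ((1 - t `^ p) `^ (p^-1 - 1)).
Proof.
move=> z01.
apply: (@integral_hyp R D f h p^-1 p^-1 (2 / p) z) => //.
- exact: measurable_itv.
- by move=> x Dx; rewrite ltW// f_gt0.
- by rewrite divr_gt0.
Qed.

End UnitInterval.

(** * Integral and series forms of M *)

Section IntegralForms.
Context {R : realType}.
Local Notation mu := (@lebesgue_measure R).
Implicit Types (p q a b x z t : R).

Lemma measurable_itv_fun (D : set R) (g : R -> R) :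
  measurable D -> measurable_fun setT g -> measurable_fun D (fun t => (g t)%:E).
Proof. by move=> mD mg; apply/measurable_EFinP/measurable_funTS. Qed.

(** The closed intervals of the definitions may be replaced by the open ones on
    which the integrands are smooth, since a point is negligible. *)
Lemma Rintegral_closed_halfline (g : R -> R) : measurable_fun setT g ->
  \int[mu]_(t in `[0, +oo[) g t = \int[mu]_(t in `]0, +oo[) g t.
Proof.
move=> mg; rewrite /Rintegral integral_itv_obnd_cbnd//.
by apply: measurable_itv_fun => //; exact: measurable_itv.
Qed.

Lemma Rintegral_closed_unit (g : R -> R) : measurable_fun setT g ->
  \int[mu]_(t in `[0, 1]) g t = \int[mu]_(t in `]0, 1[) g t.
Proof.
move=> mg; rewrite /Rintegral integral_itv_bndoo//.
by apply: measurable_itv_fun => //; exact: measurable_itv.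
Qed.

Lemma measurable_powR_comp (g : R -> R) c :
  measurable_fun setT g -> measurable_fun setT (fun t => g t `^ c).
Proof. by move=> mg; exact: measurableT_comp (measurable_powR c) mg. Qed.

Lemma measurable_affine_powR (c d p : R) :
  measurable_fun setT (fun t : R => c + d * t `^ p).
Proof.
apply: measurable_funD; first exact: measurable_cst.
by apply: measurable_funM; [exact: measurable_cst|exact: measurable_powR].
Qed.

Lemma measurable_Mpos_integrand p a b : measurable_fun setT
  (fun t => (((t `^ p + a `^ p) * (t `^ p + b `^ p)) `^ p^-1)^-1).
Proof.
rewrite (_ : (fun t => _) =
    (fun t => ((a `^ p + 1 * t `^ p) * (b `^ p + 1 * t `^ p)) `^ (- p^-1))); last first.
  by apply/funext => t; rewrite powRN !mul1r !(addrC (t `^ p)).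
apply: measurable_powR_comp.
by apply: measurable_funM; exact: measurable_affine_powR.
Qed.

Lemma halfline_cM p : 0 < p ->
  \int[mu]_(t in `]0, +oo[) ((1 + t `^ p) `^ (- (2 / p))) = (cM p)^-1.
Proof.
move=> p0; rewrite /cM invrK -Rintegral_closed_halfline.
  by apply: eq_Rintegral => t _; rewrite powRN.
apply: measurable_powR_comp.
by under eq_fun do rewrite -[X in _ + X]mul1r; exact: measurable_affine_powR.
Qed.

Lemma Mpos_hypF p x : 0 < p -> 0 < x <= 1 ->
  (Mpos p 1 x)^-1 = hypF p^-1 p^-1 (2 / p) (1 - x `^ p).
Proof.
move=> p0 x01; have z01 := onem_powR p0 x01; have /andP[z0 z1] := z01.
have xp0 : 0 < x `^ p by have /andP[x0 _] := x01; exact: powR_gt0.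
have := halfline_hypF p0 z01; have := halfline_gt0 p0; rewrite halfline_cM//.
move=> c0 E.
rewrite /Mpos invrK; apply: (mulfI (lt0r_neq0 c0)); rewrite mulKf ?gt_eqF//; last first.
  by rewrite -invr_gt0.
rewrite [RHS]mulrC -E Rintegral_closed_halfline; last exact: measurable_Mpos_integrand.
apply: eq_Rintegral => t; rewrite inE /= in_itv/= andbT => t0.
have y0 : 0 < 1 + t `^ p by rewrite ltr_pwDl// powR_ge0.
have w0 : 0 < 1 - (1 - x `^ p) / (1 + t `^ p).
  rewrite subr_gt0 ltr_pdivrMr// mul1r; have := powR_ge0 t p; lra.
have -> : (t `^ p + 1 `^ p) * (t `^ p + x `^ p) =
    (1 - (1 - x `^ p) / (1 + t `^ p)) * (1 + t `^ p) ^+ 2.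
  by rewrite powR1; field; rewrite gt_eqF.
rewrite powRM ?(ltW w0) ?exprn_ge0 ?(ltW y0)// invfM !powRN; congr (_ * _^-1).
by rewrite -powR_mulrn ?(ltW y0)// -powRrM.
Qed.

Lemma conjexpV p : 0 < p -> p != 1 -> (conjexp p)^-1 = 1 - p^-1.
Proof.
move=> p0 p1; rewrite /conjexp; field.
by rewrite gt_eqF//= subr_eq0.
Qed.

Lemma ellK_hypF p z : 0 < p -> p != 1 -> 0 <= z < 1 ->
  2 / pi_rq (conjexp p) p * ellK (conjexp p) p (z `^ p^-1) =
  hypF p^-1 p^-1 (2 / p) z.
Proof.
move=> p0 p1 z01; have /andP[z0 z1] := z01.
have := unit_interval_hypF p0 z01; have := unit_interval_gt0 p0.
set I := (X in 0 < X) => I0 E.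
have -> : pi_rq (conjexp p) p = 2 * I.
  rewrite /pi_rq conjexpV//; congr (2 * _); rewrite Rintegral_closed_unit.
    by apply: eq_Rintegral => t _; rewrite -powRN opprB.
  under eq_fun do rewrite -powRN -mulN1r.
  by apply: measurable_powR_comp; exact: measurable_affine_powR.
have -> : ellK (conjexp p) p (z `^ p^-1) = hypF p^-1 p^-1 (2 / p) z * I.
  rewrite -E /ellK conjexpV// subKr powR_invpK//.
  rewrite (_ : (fun t => _) = (fun t =>
      (1 - z * t `^ p) `^ (- p^-1) * (1 - t `^ p) `^ (p^-1 - 1))); last first.
    by apply/funext => t; rewrite invfM mulrC -!powRN opprB.
  rewrite Rintegral_closed_unit//.
  apply: measurable_funM; apply: measurable_powR_comp.
    by under eq_fun do rewrite -mulNr; exact: measurable_affine_powR.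
  by under eq_fun do rewrite -mulN1r; exact: measurable_affine_powR.
by field; rewrite gt_eqF.
Qed.

(** Substitution of c t for t; the factors c of the two brackets contribute
    c^(-2) and the differential contributes c. *)
Lemma Mpos_integral_scale p a b c : 0 < p -> 0 < a -> 0 < b -> 0 < c ->
  \int[mu]_(t in `[0, +oo[)
     (((t `^ p + (c * a) `^ p) * (t `^ p + (c * b) `^ p)) `^ p^-1)^-1 =
  c^-1 * \int[mu]_(t in `[0, +oo[)
     (((t `^ p + a `^ p) * (t `^ p + b `^ p)) `^ p^-1)^-1.
Proof.
move=> p0 a0 b0 c0.
pose G t := (((t `^ p + (c * a) `^ p) * (t `^ p + (c * b) `^ p)) `^ p^-1)^-1.
pose g t := (((t `^ p + a `^ p) * (t `^ p + b `^ p)) `^ p^-1)^-1.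
have ca0 : 0 < c * a by rewrite mulr_gt0.
have cb0 : 0 < c * b by rewrite mulr_gt0.
have w_gt0 (s t : R) : 0 <= s -> 0 < (s + (c * a) `^ p) * (s + (c * b) `^ p).
  by move=> s0; rewrite mulr_gt0// ltr_wpDl// powR_gt0.
pose W (s : R) := (((s + (c * a) `^ p) * (s + (c * b) `^ p)) `^ p^-1)^-1.
have cW s : 0 <= s -> {for s, continuous W}.
  move=> s0; apply: continuousV.
    by rewrite gt_eqF// powR_gt0// w_gt0.
  have := is_derive1_powR p^-1 (w_gt0 _ 0 s0).
  move=> /is_derive_continuous cp.
  apply: (@continuous_comp _ _ _ (fun s => (s + (c * a) `^ p) * (s + (c * b) `^ p)) (fun u => u `^ p^-1)) => //.
  by apply: cvgM; apply: cvgD; try exact: cvg_cst; exact: cvg_id.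
have G0 t : 0 <= G t by rewrite invr_ge0 powR_ge0.
have GE t : 0 <= t -> G (c * t) * c = c^-1 * g t.
  move=> t0; rewrite /G /g !(@powRM _ c) ?(ltW c0) ?(ltW a0) ?(ltW b0)// -!mulrDr mulrACA.
  have s0 : 0 <= t `^ p by exact: powR_ge0.
  have sa : 0 <= (t `^ p + a `^ p) * (t `^ p + b `^ p).
    by rewrite mulr_ge0 ?addr_ge0 ?powR_ge0.
  rewrite (powRM _ (mulr_ge0 (powR_ge0 c p) (powR_ge0 c p)) sa) (powRM _ (powR_ge0 c p) (powR_ge0 c p)).
  rewrite powR_pinvK ?(ltW c0)// !invfM.
  by rewrite -!mulrA [_ * c]mulrC mulKf ?gt_eqF.
have d (x : R) : is_derive x (1 : R) (fun s : R => c * s) c.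
  by have := is_deriveZ c (is_derive_id x (1 : R)); rewrite /GRing.scale /= mulr1.
have dE : (fun s : R => c * s)^`()%classic = fun=> c.
  by apply/funext => x; rewrite derive1E; have := d x => dx; rewrite derive_val.
have S := @increasing_ge0_integration_by_substitutiony R (fun s => c * s) G 0.
rewrite dE mulr0 in S.
have {}S : (\int[mu]_(x in `[0%R, +oo[) (G x)%:E =
            c^-1%:E * \int[mu]_(x in `[0%R, +oo[) (g x)%:E)%E.
  transitivity (\int[mu]_(x in `[0%R, +oo[)
      (((G \o (fun s => c * s)%R) * (fun=> c))%R x)%:E)%E; first apply: S.
  - by move=> x y _ _ xy; rewrite ltr_pM2l.
  - by move=> x _; exact: cst_continuous.
  - exact: is_cvg_cst.
  - exact: is_cvg_cst.
  - split; first by move=> x _; have := d x => dx; exact: ex_derive.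
    apply: cvg_at_right_filter; apply: is_derive_continuous (d 0).
  - exact: gt0_cvgMry.
  - apply/continuous_within_itvcyP; split.
      move=> x; rewrite in_itv/= andbT => x0.
      apply: (@continuous_comp _ _ _ (fun t : R => t `^ p) W).
        exact: is_derive_continuous (is_derive1_powR p x0).
      by apply: cW; exact: powR_ge0.
    have -> : G 0 = W 0 by rewrite /G /W powR0// gt_eqF.
    by apply: (@cvg_comp _ _ _ (fun t : R => t `^ p) W _ _ _ (powR_cvg0 p0)); exact: (cW 0 (lexx 0)).
  - by move=> x _.
  - rewrite -ge0_integralZl//; last 3 first.
    + apply: (@measurable_itv_fun _ g); first exact: measurable_itv.
      exact: measurable_Mpos_integrand.
    + by move=> x _; rewrite lee_fin invr_ge0 powR_ge0.
    + by rewrite lee_fin invr_ge0 ltW.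
    apply: eq_integral => x; rewrite inE /= in_itv/= andbT => x0.
    by rewrite -EFinM -GE.
transitivity (fine (c^-1%:E * \int[mu]_(x in `[0%R, +oo[) (g x)%:E)%E).
  exact: (congr1 fine S).
rewrite /Rintegral -/g; case: (\int[mu]_(x in _) _)%E => [r| |] //=.
- by rewrite gt0_muley ?lte_fin ?invr_gt0//= mulr0.
- by rewrite gt0_muleNy ?lte_fin ?invr_gt0//= mulr0.
Qed.

End IntegralForms.

(** * Symmetry, homogeneity and limiting values *)

Section MeanProperties.
Context {R : realType}.
Implicit Types (p q a b x z t : R).

Lemma lim_funext (F : set_system R) (f g : R -> R) :
  (forall x, f x = g x) -> lim (f @ F) = lim (g @ F).
Proof. by move=> /funext ->. Qed.

Lemma MposC p a b : Mpos p a b = Mpos p b a.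
Proof.
have e : (fun t => (((t `^ p + a `^ p) * (t `^ p + b `^ p)) `^ p^-1)^-1) =
         (fun t => (((t `^ p + b `^ p) * (t `^ p + a `^ p)) `^ p^-1)^-1).
  by apply/funext => t; rewrite (mulrC (t `^ p + a `^ p)).
exact: (congr1 (fun G : R -> R => (cM p * \int[@lebesgue_measure R]_(t in `[0, +oo[) G t)^-1) e).
Qed.

Lemma KgenC p a b : Kgen p a b = Kgen p b a.
Proof.
rewrite /Kgen eq_sym; case: eqP => [->//|_]; congr (_ * _).
by rewrite -(opprB (b `^ p)) -(opprB (b `^ (p - 1))) invrN mulrNN.
Qed.

Lemma MC p a b : M p a b = M p b a.
Proof.
rewrite /M; case: (p == 0); last exact: MposC.
by apply: lim_funext => q; exact: MposC.
Qed.

Lemma KC p a b : K p a b = K p b a.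
Proof.
rewrite /K; case: ((p == 0) || (p == 1)); last exact: KgenC.
by apply: lim_funext => q; exact: KgenC.
Qed.

Lemma Mpos_scale p a b : 0 < p -> 0 < a -> 0 < b -> Mpos p a b = a * Mpos p 1 (b / a).
Proof.
move=> p0 a0 b0.
have := @Mpos_integral_scale R p 1 (b / a) a p0 ltr01 (divr_gt0 b0 a0) a0.
rewrite mulr1 mulrCA divff ?mulr1 ?gt_eqF// => S.
transitivity ((cM p * (a^-1 * \int[@lebesgue_measure R]_(t in `[0, +oo[)
    (((t `^ p + 1 `^ p) * (t `^ p + (b / a) `^ p)) `^ p^-1)^-1))^-1).
  exact: (congr1 (fun u => (cM p * u)^-1) S).
by rewrite mulrCA invfM invrK.
Qed.

Lemma Kgen_scale p a b : 0 < a -> 0 < b -> Kgen p a b = a * Kgen p 1 (b / a).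
Proof.
move=> a0 b0; rewrite /Kgen.
have -> : (1 == b / a) = (a == b).
  by rewrite -(inj_eq (mulfI (lt0r_neq0 a0))) mulr1 mulrCA divff ?mulr1 // gt_eqF.
case: eqP => [|_]; first by rewrite mulr1.
have e q : a `^ q - b `^ q = a `^ q * (1 `^ q - (b / a) `^ q).
  rewrite powR1 mulrBr mulr1 -powRM ?divr_ge0 ?(ltW a0) ?(ltW b0)//.
  by rewrite mulrCA divff ?mulr1// gt_eqF.
rewrite !e invfM; set u := 1 `^ p - _; set v := (1 `^ (p - 1) - _)^-1.
have ap : a `^ p = a * a `^ (p - 1).
  transitivity (a `^ (1 + (p - 1))); first by rewrite addrC subrK.
  rewrite (@powRD R a 1 (p - 1)); first by rewrite powRr1// ltW.
  by rewrite (gt_eqF a0) implybT.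
rewrite ap; have : a `^ (p - 1) != 0 by rewrite gt_eqF// powR_gt0.
move: v (p - 1) (a `^ (p - 1)) => v d c c0.
have -> : d / p * (a * c * u * (c^-1 * v)) = a * (d / p * (u * v)) * (c / c) by ring.
by rewrite divff// mulr1.
Qed.

(** Minus the difference quotient at 0 of the function s |-> x^s, extended by
    continuity.  Since K_q(1, x) = powq x q / powq x (q - 1) away from 0 and 1,
    its continuity gives the limits that define K_0 and K_1. *)
Definition powq x s : R := if s == 0 then - ln x else (1 - x `^ s) / s.

Lemma is_derive_powR_exponent x s : 0 < x ->
  is_derive s (1 : R) (fun u => x `^ u) (ln x * x `^ s).
Proof.
move=> x0.
have -> : (fun u => x `^ u) = (fun u => expR (u * ln x)).
  by apply/funext => u; rewrite /powR gt_eqF.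
have h : is_derive s (1 : R) (fun u : R => u * ln x) (ln x).
  have := is_deriveM (is_derive_id s (1 : R)) (is_derive_cst (ln x) s (1 : R)).
  by move=> /is_derive_eq; apply; rewrite /GRing.scale /= mulr0 add0r mulr1.
have := @is_derive1_comp R expR (fun u : R => u * ln x) s _ _ (is_derive_expR _) h.
by rewrite mulrC /powR gt_eqF.
Qed.

Lemma derive_quotient (f : R -> R) (x df : R) : is_derive x (1 : R) f df ->
  (f (h + x) - f x) / h @[h --> 0^'] --> df.
Proof.
move=> dfx; have [df1 df2] := dfx.
rewrite -df2; apply: cvg_trans df1.
apply: near_eq_cvg; apply: nearW => h.
by rewrite /GRing.scale /= mulr1 mulrC.
Qed.

Lemma near_neq (s c : R) : s != c -> \forall u \near s, u != c.
Proof. by move=> sc; apply: open_nbhs_nbhs; split; [exact: open_neq|]. Qed.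

Lemma dnbhs_neq (s c : R) : \forall u \near s^', u != c.
Proof.
have [->|sc] := eqVneq s c; first exact: nbhs_dnbhs_neq.
by apply: nbhs_dnbhs; exact: near_neq.
Qed.

Lemma powq_continuous x s : 0 < x -> {for s, continuous (powq x)}.
Proof.
move=> x0; have [->|s0] := eqVneq s 0.
  apply/continuous_withinNx; rewrite {2}/powq eqxx.
  have := derive_quotient (is_derive_powR_exponent 0 x0); rewrite powRr0 mulr1 => /cvgN.
  apply: cvg_trans; apply: near_eq_cvg; near=> h.
  have h0 : h != 0 by near: h; exact: nbhs_dnbhs_neq.
  by rewrite /powq (negbTE h0) opprfctE addr0 -mulNr opprB.
have E : \forall u \near s, (1 - x `^ u) / u = powq x u.
  near=> u; have u0 : u != 0 by near: u; exact: near_neq.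
  by rewrite /powq (negbTE u0).
have L : (1 - x `^ u) / u @[u --> s] --> powq x s.
  rewrite /powq (negbTE s0).
  apply: cvgM; last by apply: cvgV => //; exact: cvg_id.
  apply: cvgB; first exact: cvg_cst.
  exact: is_derive_continuous (is_derive_powR_exponent s x0).
by apply: cvg_trans L; exact: near_eq_cvg.
Unshelve. all: by end_near. Qed.

Lemma powq_gt0 x s : 0 < x < 1 -> 0 < powq x s.
Proof.
move=> /andP[x0 x1]; rewrite /powq; case: eqP => [_|/eqP s0].
  by rewrite oppr_gt0 ln_lt0// x0.
have lx : ln x < 0 by rewrite ln_lt0// x0.
have [sl|sg|sz] := ltgtP s 0; last by rewrite sz eqxx in s0.
  by rewrite ltr_ndivlMr// mul0r subr_lt0 /powR gt_eqF// expR_gt1 nmulr_lgt0.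
by rewrite divr_gt0// subr_gt0 /powR gt_eqF// expR_lt1 pmulr_rlt0.
Qed.

Lemma Kgen_powq q x : 0 < x < 1 -> q != 0 -> q != 1 ->
  Kgen q 1 x = powq x q / powq x (q - 1).
Proof.
move=> /andP[x0 x1] q0 q1; rewrite /Kgen (gt_eqF x1) /powq (negbTE q0) subr_eq0 (negbTE q1).
by rewrite !powR1 invf_div; ring.
Qed.

Lemma K_powq q a b : 0 < b < a -> K q a b = a * (powq (b / a) q / powq (b / a) (q - 1)).
Proof.
move=> /andP[b0 ba]; have a0 := lt_trans b0 ba.
have x01 : 0 < b / a < 1 by rewrite divr_gt0//= ltr_pdivrMr// mul1r.
set x := b / a in x01 *; have /andP[x0 x1] := x01.
rewrite /K; case: ifPn => q01; last first.
  by move: q01; rewrite negb_or => /andP[q0 q1]; rewrite Kgen_scale// Kgen_powq.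
apply/cvg_lim => //.
apply: (@cvg_trans _ ((a * (powq x r / powq x (r - 1))) @[r --> q^'])).
  apply: near_eq_cvg; near=> r.
  have r0 : r != 0 by near: r; exact: dnbhs_neq.
  have r1 : r != 1 by near: r; exact: dnbhs_neq.
  by rewrite Kgen_scale// Kgen_powq.
apply: cvg_within_filter; apply: cvgMr; apply: cvgM.
  exact: powq_continuous.
apply: cvgV; first by rewrite gt_eqF// powq_gt0.
apply: (@cvg_comp _ _ _ (fun r : R => r - 1) (powq x) _ (nbhs (q - 1))).
  by apply: cvgB; [exact: cvg_id|exact: cvg_cst].
exact: powq_continuous.
Unshelve. all: by end_near. Qed.

End MeanProperties.

(** * Comparison of the two means *)

Section Comparison.
Context {R : realType}.
Implicit Types (p q a b x z t : R).

Lemma onem_powR_gt0 p x : 0 < p -> 0 < x < 1 -> 0 < 1 - x `^ p < 1.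
Proof.
move=> p0 /andP[x0 x1]; have xp0 : 0 < x `^ p by exact: powR_gt0.
have xp1 : x `^ p < 1.
  apply: (@lt_le_trans _ _ (1 `^ p)); last by rewrite powR1.
  by apply: gt0_ltr_powR; rewrite ?nnegrE ?(ltW x0).
by apply/andP; split; lra.
Qed.

Lemma quadratic_onem a b y : 0 < a -> 0 < b -> 0 < y <= 1 ->
  hypF a b (2 * b) (1 - y) =
  ((1 + y) / 2) `^ (- a) *
  hypF (a / 2) (a / 2 + 2^-1) (b + 2^-1) (((1 - y) / (1 + y)) ^+ 2).
Proof.
move=> a0 b0 /andP[y0 y1]; rewrite quadratic_transformation//; last first.
  by apply/andP; split; lra.
have -> : 1 - (1 - y) / 2 = (1 + y) / 2 by field.
by have -> : 2 - (1 - y) = 1 + y by ring.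
Qed.

Lemma Mpos_quadratic p x : 0 < p -> 0 < x <= 1 ->
  (Mpos p 1 x)^-1 = ((1 + x `^ p) / 2) `^ (- p^-1) *
    hypF (2 * p)^-1 ((2 * p)^-1 + 2^-1) (p^-1 + 2^-1)
      (((1 - x `^ p) / (1 + x `^ p)) ^+ 2).
Proof.
move=> p0 x01; rewrite Mpos_hypF// quadratic_onem ?invr_gt0//.
  by rewrite (_ : p^-1 / 2 = (2 * p)^-1) // invfM mulrC.
by have /andP[] := onem_powR p0 x01; lra.
Qed.

Lemma K_hypF_lt1 p x : 0 < p -> 0 < x < 1 ->
  (K p 1 x)^-1 = hypF 1 p^-1 2 (1 - x `^ p).
Proof.
move=> p0 x01; have /andP[x0 x1] := x01.
have z01 := onem_powR_gt0 p0 x01; have /andP[z0 z1] := z01.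
have z01' : 0 <= 1 - x `^ p < 1 by rewrite z1 ltW.
rewrite K_powq ?x0// divr1 mul1r invf_div.
apply: (mulfI (lt0r_neq0 z0)).
have [->|p1] := eqVneq p 1.
  rewrite invr1 powRr1 ?(ltW x0)// hypF12_log; last by apply/andP; split; lra.
  rewrite subKr subrr /powq eqxx oner_eq0 powRr1 ?(ltW x0)// divr1.
  by rewrite mulrC divfK// gt_eqF//; lra.
have pi1 : p^-1 != 1 by rewrite invr_eq1.
rewrite hypF12_power ?invr_gt0// subKr -powRrM mulrBr mulr1 divff ?gt_eqF//.
rewrite /powq (gt_eqF p0) subr_eq0 (negbTE p1) invf_div.
by field; rewrite (gt_eqF p0) (gt_eqF z0) subr_eq0 p1.
Qed.

Lemma K_hypF p x : 0 < p -> p != 1 -> 0 < x <= 1 ->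
  (K p 1 x)^-1 = hypF 1 p^-1 2 (1 - x `^ p).
Proof.
move=> p0 p1 /andP[x0]; rewrite le_eqVlt => /predU1P[->|x1]; last first.
  by rewrite K_hypF_lt1// x0.
by rewrite powR1 subrr hypF_at0 /K (gt_eqF p0) (negbTE p1) /= /Kgen eqxx invr1.
Qed.

Lemma hypF_K_quadratic p x : 0 < p -> 0 < x <= 1 ->
  hypF 1 p^-1 2 (1 - x `^ p) = ((1 + x `^ p) / 2) `^ (- p^-1) *
    hypF (2 * p)^-1 ((2 * p)^-1 + 2^-1) (3 / 2)
      (((1 - x `^ p) / (1 + x `^ p)) ^+ 2).
Proof.
move=> p0 x01; rewrite hypFC -[in LHS](mulr1 2) quadratic_onem ?invr_gt0//.
  rewrite (_ : p^-1 / 2 = (2 * p)^-1); last by rewrite invfM mulrC.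
  by rewrite (_ : 1 + 2^-1 = 3 / 2) //; field.
by have /andP[] := onem_powR p0 x01; lra.
Qed.

Lemma zeta_bounds (y : R) : 0 < y < 1 -> 0 < ((1 - y) / (1 + y)) ^+ 2 < 1.
Proof.
move=> /andP[y0 y1].
have d0 : 0 < (1 - y) / (1 + y) by apply: divr_gt0; lra.
have d1 : (1 - y) / (1 + y) < 1 by rewrite ltr_pdivrMr; lra.
by apply/andP; split; [exact: exprn_gt0 | rewrite expr_lt1// ltW].
Qed.

Lemma Mpos_gt0 p x : 0 < p -> 0 < x <= 1 -> 0 < Mpos p 1 x.
Proof.
move=> p0 x01; rewrite -invr_gt0 Mpos_hypF//.
have pi0 : 0 < p^-1 by rewrite invr_gt0.
have g0 : 0 < 2 / p by rewrite divr_gt0.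
exact: lt_le_trans ltr01 (hypF_ge1 pi0 pi0 g0 (onem_powR p0 x01)).
Qed.

(** With third parameter 1/(2p) + 1/2 the quadratic form of 1 / M_p would be a
    power, namely x^(-1/2), because 1 - zeta^2 = 4 x^p / (1 + x^p)^2; the actual
    third parameter 1/p + 1/2 is larger. *)
Lemma Mpos_gt_geometric p x : 0 < p -> 0 < x < 1 -> x `^ 2^-1 < Mpos p 1 x.
Proof.
move=> p0 x01; have /andP[x0 x1] := x01; have x01' : 0 < x <= 1 by rewrite x0 ltW.
have M0 := Mpos_gt0 p0 x01'.
have /andP[z0 z1] := onem_powR_gt0 p0 x01.
set y := x `^ p in z0 z1; have y0 : 0 < y by lra.
have y1 : y < 1 by lra.
have y01 : 0 < y < 1 by rewrite y0.
have A0 : 0 < (1 + y) / 2 by lra.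
have al0 : 0 < (2 * p)^-1 by rewrite invr_gt0 mulr_gt0.
have pi : p^-1 = 2 * (2 * p)^-1 by field; rewrite gt_eqF.
rewrite -ltf_pV2 ?posrE ?powR_gt0// Mpos_quadratic// -/y.
have -> : (x `^ 2^-1)^-1 = ((1 + y) / 2) `^ (- p^-1) *
    (1 - ((1 - y) / (1 + y)) ^+ 2) `^ (- (2 * p)^-1).
  have -> : 1 - ((1 - y) / (1 + y)) ^+ 2 = y / ((1 + y) / 2) ^+ 2.
    by field; rewrite gt_eqF//; lra.
  have yE : x = y `^ p^-1 by rewrite /y powR_pinvK// ltW.
  rewrite [in LHS]yE -powRrM -powRN.
  have B0 : 0 <= ((1 + y) / 2) ^- 2 by rewrite invr_ge0 exprn_ge0// ltW.
  rewrite (powRM _ (ltW y0) B0) -(powR_invn 2 (ltW A0)) -[in RHS]powRrM mulrCA.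
  rewrite -(@powRD _ ((1 + y) / 2)); last by rewrite (gt_eqF A0) implybT.
  have -> : - p^-1 + - 2%:R * - (2 * p)^-1 = 0 by rewrite pi; ring.
  rewrite powRr0 mulr1; congr (_ `^ _); rewrite pi; field.
  by rewrite gt_eqF.
rewrite ltr_pM2l ?powR_gt0//.
have zb := zeta_bounds y01; have /andP[zb0 zb1] := zb.
have be0 : 0 < (2 * p)^-1 + 2^-1 by rewrite addr_gt0// invr_gt0.
have zb' : 0 <= ((1 - y) / (1 + y)) ^+ 2 < 1 by rewrite zb1 ltW.
rewrite -(hypF_same al0 be0 zb'); apply: hypF_lt => //.
by rewrite pi; lra.
Qed.

(** The hypergeometric factor of the quadratic form is at least 1. *)
Lemma Mpos_le_power_mean p x : 0 < p -> 0 < x < 1 ->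
  Mpos p 1 x <= ((1 + x `^ p) / 2) `^ p^-1.
Proof.
move=> p0 x01; have /andP[x0 x1] := x01; have x01' : 0 < x <= 1 by rewrite x0 ltW.
have M0 := Mpos_gt0 p0 x01'.
have y0 : 0 < x `^ p by exact: powR_gt0.
have A0 : 0 < (1 + x `^ p) / 2 by lra.
rewrite -lef_pV2 ?posrE ?powR_gt0// Mpos_quadratic// -powRN.
rewrite ler_pMr ?powR_gt0//; apply: hypF_ge1; rewrite ?addr_gt0 ?invr_gt0 ?mulr_gt0//.
have /andP[z0 z1] := onem_powR_gt0 p0 x01.
by have /andP[? ->] : 0 < ((1 - x `^ p) / (1 + x `^ p)) ^+ 2 < 1; rewrite ?andbT ?ltW//; apply: zeta_bounds; apply/andP; split; lra.
Qed.

(** The logarithm of the power mean is the difference quotient at 0 of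
    q |-> ln ((1 + x^q) / 2). *)
Lemma power_mean_cvg x : 0 < x ->
  ((1 + x `^ q) / 2) `^ q^-1 @[q --> 0^'] --> x `^ 2^-1.
Proof.
move=> x0.
pose g q := ln ((1 + x `^ q) / 2).
have dg : is_derive (0 : R) (1 : R) g (2^-1 * ln x).
  have d1 : is_derive (0 : R) (1 : R) (fun q => (1 + x `^ q) / 2) (2^-1 * ln x).
    have d0 := is_derive_powR_exponent 0 x0.
    have d2 : is_derive (0 : R) (1 : R) (fun q => 1 + x `^ q) (ln x * x `^ 0).
      by rewrite -[X in is_derive _ _ _ X]add0r; apply: is_deriveD.
    have := is_deriveZ 2^-1 d2; rewrite powRr0 mulr1 /GRing.scale /=.
    rewrite (_ : (fun q => (1 + x `^ q) / 2) = (fun q => 2^-1 * (1 + x `^ q)))//.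
    by apply/funext => q; rewrite mulrC.
  have y0 : 0 < (1 + x `^ 0) / 2 by rewrite powRr0; lra.
  have := @is_derive1_comp R (@ln R) (fun q => (1 + x `^ q) / 2) 0 _ _ (is_derive1_ln y0) d1.
  move=> /is_derive_eq; apply; rewrite powRr0.
  by rewrite (_ : (1 + 1) / 2 = 1) ?invr1 ?mul1r//; field.
have := derive_quotient dg; rewrite {2}/g powRr0 (_ : (1 + 1) / 2 = 1); last by field.
rewrite ln1 => L.
have -> : x `^ 2^-1 = expR (2^-1 * ln x) by rewrite /powR gt_eqF.
apply: cvg_trans (@cvg_comp _ _ _ _ (@expR R) _ _ _ L (@continuous_expR R _)).
apply: near_eq_cvg; apply: nearW => h /=.
have y0 : 0 < (1 + x `^ h) / 2 by rewrite divr_gt0// addr_gt0// powR_gt0.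
by rewrite addr0 subr0 /g {2}/powR gt_eqF// mulrC.
Qed.

Lemma M_pos p a b : 0 < p -> M p a b = Mpos p a b.
Proof. by move=> p0; rewrite /M gt_eqF. Qed.

Lemma M0_geometric a b : 0 < b < a -> M 0 a b = a * (b / a) `^ 2^-1.
Proof.
move=> /andP[b0 ba]; have a0 := lt_trans b0 ba.
have x01 : 0 < b / a < 1 by rewrite divr_gt0//= ltr_pdivrMr// mul1r.
have /andP[x0 x1] := x01.
rewrite /M eqxx; apply/cvg_lim => //.
apply: (@cvg_trans _ ((a * Mpos q 1 (b / a)) @[q --> 0^'+])).
  apply: near_eq_cvg; near=> q.
  have q0 : 0 < q by near: q; exact: nbhs_right_gt.
  by rewrite [RHS]Mpos_scale.
apply: cvgMr.
have up : ((1 + (b / a) `^ q) / 2) `^ q^-1 @[q --> 0^'+] --> (b / a) `^ 2^-1.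
  exact: cvg_dnbhs_at_right (power_mean_cvg x0).
apply: (squeeze_cvgr _ (cvg_cst ((b / a) `^ 2^-1)) up).
near=> q; have q0 : 0 < q by near: q; exact: nbhs_right_gt.
by rewrite (Mpos_le_power_mean q0 x01) ltW// Mpos_gt_geometric.
Unshelve. all: by end_near. Qed.

Lemma K_scale q a b : 0 < b < a -> K q a b = a * K q 1 (b / a).
Proof.
move=> ba; rewrite K_powq//; have /andP[b0 ba'] := ba; have a0 := lt_trans b0 ba'.
by rewrite [in RHS]K_powq ?divr1 ?mul1r// divr_gt0//= ltr_pdivrMr// mul1r.
Qed.

Lemma K_gt0 q x : 0 < x < 1 -> 0 < K q 1 x.
Proof. by move=> x01; rewrite K_powq// divr1 mul1r divr_gt0// powq_gt0. Qed.

Lemma K_vs_M p x : 0 < p -> 0 < x < 1 ->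
  [/\ p < 1 -> K p 1 x < Mpos p 1 x,
      p = 1 -> Mpos p 1 x = K p 1 x &
      1 < p -> Mpos p 1 x < K p 1 x].
Proof.
move=> p0 x01; have /andP[x0 x1] := x01; have x01' : 0 < x <= 1 by rewrite x0 ltW.
have M0 := Mpos_gt0 p0 x01'; have K0 := K_gt0 p x01.
have /andP[z0 z1] := onem_powR_gt0 p0 x01.
have y01 : 0 < x `^ p < 1 by apply/andP; split; lra.
have C0 : 0 < ((1 + x `^ p) / 2) `^ (- p^-1) by rewrite powR_gt0//; lra.
have al0 : 0 < (2 * p)^-1 by rewrite invr_gt0 mulr_gt0.
have h2 : (0 : R) < 2^-1 by rewrite invr_gt0.
have pi0 : 0 < p^-1 by rewrite invr_gt0.
have zb := zeta_bounds y01.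
split => [p1|p1|p1].
- rewrite -ltf_pV2 ?posrE// Mpos_quadratic// K_hypF_lt1// hypF_K_quadratic//.
  rewrite ltr_pM2l//; apply: hypF_lt => //; first by rewrite addr_gt0.
  have : 1 < p^-1 by rewrite invf_gt1.
  lra.
- apply: invr_inj; rewrite Mpos_hypF// K_hypF_lt1// p1 invr1.
  by rewrite mulr1.
- rewrite -ltf_pV2 ?posrE// Mpos_quadratic// K_hypF_lt1// hypF_K_quadratic//.
  rewrite ltr_pM2l//; apply: hypF_lt => //; rewrite ?addr_gt0//.
  have : p^-1 < 1 by rewrite invf_lt1.
  lra.
Qed.

(** K_0(1, x) = x / L(1, x) and L(1, x) = K_1(1, x) = M_1(1, x) > sqrt x. *)
Lemma K0_lt_M0 a b : 0 < b < a -> K 0 a b < M 0 a b.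
Proof.
move=> ba; have /andP[b0 ba'] := ba; have a0 := lt_trans b0 ba'.
rewrite M0_geometric// K_powq// ltr_pM2l//.
have x01 : 0 < b / a < 1 by rewrite divr_gt0//= ltr_pdivrMr// mul1r.
have /andP[x0 x1] := x01; move: (b / a) x01 x0 x1 => x x01 x0 x1.
have := Mpos_gt_geometric ltr01 x01.
have [_ -> // _] := K_vs_M ltr01 x01.
rewrite K_powq ?x0// divr1 mul1r subrr => L.
have -> : powq x 0 / powq x (0 - 1) = x / (powq x 1 / powq x 0).
  have q1 : powq x (0 - 1) = powq x 1 / x.
    rewrite sub0r /powq oppr_eq0 oner_eq0 powRr1 ?(ltW x0)// powR_inv1 ?(ltW x0)//.
    by field; rewrite gt_eqF.
  rewrite q1; field.
  by rewrite !gt_eqF ?powq_gt0.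
rewrite ltr_pdivrMr ?divr_gt0 ?powq_gt0//.
have xE : x = x `^ 2^-1 * x `^ 2^-1.
  rewrite -powRD ?(gt_eqF x0) ?implybT// (_ : 2^-1 + 2^-1 = 1) ?powRr1 ?(ltW x0)//.
  by field.
by rewrite {1}xE ltr_pM2l// powR_gt0.
Qed.

Lemma K_vs_M_ordered a b : 0 < b < a ->
  [/\ forall p : R, 0 <= p < 1 -> K p a b < M p a b,
      M 1 a b = K 1 a b &
      forall p : R, 1 < p -> M p a b < K p a b].
Proof.
move=> ba; have /andP[b0 ba'] := ba; have a0 := lt_trans b0 ba'.
have x01 : 0 < b / a < 1 by rewrite divr_gt0//= ltr_pdivrMr// mul1r.
split => [p /andP[]||p p1].
- rewrite le_eqVlt => /predU1P[<- _|p0 p1]; first exact: K0_lt_M0.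
  rewrite K_scale// M_pos// Mpos_scale// ltr_pM2l//.
  by have [-> //] := K_vs_M p0 x01.
- rewrite K_scale// M_pos// Mpos_scale//.
  by have [_ -> //] := K_vs_M ltr01 x01.
- have p0 : 0 < p by exact: lt_trans p1.
  rewrite K_scale// M_pos// Mpos_scale// ltr_pM2l//.
  by have [_ _ -> //] := K_vs_M p0 x01.
Qed.

End Comparison.

Unset Implicit Arguments.
Set Strict Implicit.

Theorem theorem1p2 (R : realType) :
  (forall p x : R, 0 < p -> p != 1 -> 0 < x <= 1 ->
    [/\ (M p 1 x)^-1 =
          2 / pi_rq (conjexp p) p * ellK (conjexp p) p ((1 - x `^ p) `^ p^-1),
        (M p 1 x)^-1 = hypF p^-1 p^-1 (2 / p) (1 - x `^ p) &
        (M p 1 x)^-1 =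
          ((1 + x `^ p) / 2) `^ (- p^-1) *
          hypF (2 * p)^-1 ((2 * p)^-1 + 2^-1) (p^-1 + 2^-1)
               (((1 - x `^ p) / (1 + x `^ p)) ^+ 2)] /\
    [/\ (K p 1 x)^-1 = hypF 1 p^-1 2 (1 - x `^ p) &
        (K p 1 x)^-1 =
          ((1 + x `^ p) / 2) `^ (- p^-1) *
          hypF (2 * p)^-1 ((2 * p)^-1 + 2^-1) (3 / 2)
               (((1 - x `^ p) / (1 + x `^ p)) ^+ 2)]) /\
  (forall a b : R, 0 < a -> 0 < b -> a != b ->
    [/\ forall p : R, 0 <= p < 1 -> K p a b < M p a b,
        M 1 a b = K 1 a b &
        forall p : R, 1 < p -> M p a b < K p a b]).
Proof.
split => [p x p0 p1 x01|a b a0 b0 ab].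
  have z01 := onem_powR p0 x01.
  split; last first.
    by split; rewrite K_hypF// hypF_K_quadratic.
  rewrite M_pos// ellK_hypF//; split; [exact: Mpos_hypF|exact: Mpos_hypF|].
  exact: Mpos_quadratic.
have [ab'|ba|e] := ltgtP a b; last by rewrite e eqxx in ab.
  have ba : 0 < a < b by rewrite a0.
  have [h1 h2 h3] := K_vs_M_ordered ba.
  by split => [p p01||p p1]; rewrite MC KC; [exact: h1|exact: h2|exact: h3].
by apply: K_vs_M_ordered; rewrite b0.
Qed.
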